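(* Let $\lambda$ be a partition, and let $\lambda=\mu^1<^L\mu^2<^L\cdots<^L\mu^s$ be all partitions $\mu$ with $\mu\ge\lambda$ in dominance order, listed in increasing reverse lexicographic order. Let $M_\lambda=(r_{ij})_{s\times s}$ with $r_{ij}=r_{\mu^j\mu^i}$. Write $Q_\lambda(\alpha)=\sum_{i=1}^sC_{\lambda\mu^i}(\alpha)q_{\mu^i}(\alpha)$ and $X_\lambda=(C_{\lambda\mu^1}(\alpha),\dots,C_{\lambda\mu^s}(\alpha))^t$. Then $M_\lambda X_\lambda=e'_\lambda(\alpha)X_\lambda$, and $$Q_\lambda(\alpha)=c_\lambda\det N_\lambda,$$ where $c_\lambda=\prod_{i=2}^s\big(e'_{\mu^i}(\alpha)-e'_{\mu^1}(\alpha)\big)^{-1}$ and $N_\lambda$ is the matrix $M_\lambda-e'_\lambda(\alpha)\,\mathrm{Id}$ with its first row replaced by $(q_{\mu^1}(\alpha),q_{\mu^2}(\alpha),\dots,q_{\mu^s}(\alpha))$.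
   Context: $F=\mathbb{Q}(\alpha)$, $\Lambda_F=F[p_1,p_2,\dots]$ ($p_n$ power sums). For a partition $\lambda$: $l(\lambda)$ number of parts, $m_a(\lambda)$ the number of parts equal to $a$, $z_\lambda=\prod_ii^{m_i(\lambda)}m_i(\lambda)!$. Scalar product $\langle p_\lambda,p_\mu\rangle=\delta_{\lambda\mu}\alpha^{l(\lambda)}z_\lambda$. Jack $P_\lambda(\alpha)$: the pairwise orthogonal functions of the form $m_\lambda+\sum_{\mu<\lambda}c_{\lambda\mu}m_\mu$ (dominance order, $m_\mu$ monomials); $Q_\lambda=\langle P_\lambda,P_\lambda\rangle^{-1}P_\lambda$. $Q_n(\alpha)=\sum_{\lambda\vdash n}\alpha^{-l(\lambda)}z_\lambda^{-1}p_\lambda$ ($Q_0=1$), $q_\lambda=Q_{\lambda_1}Q_{\lambda_2}\cdots$. Reverse lexicographic order: $\lambda>^L\mu$ if the first nonzero difference $\lambda_i-\mu_i$ is positive. $e'_\lambda(\alpha)=\frac12\alpha\sum_i\lambda_i^2-\sum_ii\lambda_i$. Moving up operator: for $i<j$ and $0<k\le\lambda_j$, $r^i_j(k).\lambda$ is the rearrangement in decreasing order of $(\lambda_1,\dots,\lambda_i+k,\dots,\lambda_j-k,\dots)$. Coefficients $r_{\lambda\mu}$: $r_{\nu\nu}=e'_\nu(\alpha)$; for $\mu=r^i_j(k).\lambda$, $r_{\lambda\mu}=(1+\delta_{\lambda_i\lambda_j})^{-1}m_{\lambda_i}(\lambda)(m_{\lambda_j}(\lambda)-\delta_{\lambda_i\lambda_j})(\lambda_i-\lambda_j+2k)$;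 $r_{\lambda\mu}=0$ otherwise. *)

(* Defs.v *)
From HB Require Import structures.
From mathcomp Require Import all_boot all_order all_algebra.
From mathcomp Require Import fraction.
From mathcomp Require Import mpoly.

Set Implicit Arguments.
Unset Strict Implicit.
Unset Printing Implicit Defensive.

Import Order.TTheory GRing.Theory Num.Theory.
Definition F : fieldType := {fraction {poly rat}}.
Definition alpha : F := FracField.tofrac ('X : {poly rat}).

Definition is_part (la : seq nat) : bool :=
  sorted geq la && all (fun x => 0 < x)%N la.

Definition dom_le (la mu : seq nat) : bool :=
  (sumn la == sumn mu) &&
  all (fun k => sumn (take k la) <= sumn (take k mu))%N
      (iota 0 (size la + size mu).+1).

Definition rlex_lt (la mu : seq nat) : bool :=
  has (fun i => (nth 0 la i < nth 0 mu i)%N &&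
                all (fun j => nth 0 la j == nth 0 mu j) (iota 0 i))
      (iota 0 (size la + size mu)).

(* moving up operator r^i_j(k) (indices 0-based here: i < j < size la) *)
Definition moveup (la : seq nat) (i j k : nat) : seq nat :=
  sort geq (filter (fun x => 0 < x)%N
    (set_nth 0 (set_nth 0 la i (nth 0 la i + k)) j (nth 0 la j - k))).

Definition moveup_ok (la mu : seq nat) (t : 'I_(size la) * 'I_(size la) * 'I_(sumn la).+1) : bool :=
  let: (i, j, k) := t in
  [&& i < j, 0 < k, k <= nth 0 la j & moveup la i j k == mu].

Local Open Scope ring_scope.

Definition eprime (la : seq nat) : F :=
  2%:R^-1 * alpha * (\sum_(x <- la) x ^ 2)%N%:R
  - (\sum_(i < size la) (i.+1 * nth 0 la i))%N%:R.

Definition r_formula (la : seq nat) (i j k : nat) : F :=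
  let a := nth 0 la i in let b := nth 0 la j in
  let d : F := (a == b)%:R in
  (1 + d)^-1 * (count_mem a la)%:R * ((count_mem b la)%:R - d)
   * (a%:R - b%:R + 2%:R * k%:R).

Definition r_coef (la mu : seq nat) : F :=
  if mu == la then eprime la else
  if [pick t | @moveup_ok la mu t] is Some (i, j, k)
  then r_formula la i j k else 0.

(* Symmetric functions of degree <= n: Lambda_F truncated to
   F[p_1, ..., p_n]; variable i : 'I_n stands for p_(i+1).           *)
Notation Lam n := {mpoly F[n]}.

Definition pwt n (m : 'X_{1..n}) : nat := (\sum_(i < n) i.+1 * m i)%N.

(* z_la = prod_i i^{m_i} m_i!  for la encoded by multiplicities m *)
Definition zee n (m : 'X_{1..n}) : nat := (\prod_(i < n) (i.+1 ^ m i * (m i)`!))%N.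

(* <p_la, p_mu> = delta alpha^{l(la)} z_la, extended bilinearly; l(la) = mdeg m *)
Definition sprod n (f g : Lam n) : F :=
  \sum_(m <- msupp f) f@_m * g@_m * (alpha ^+ mdeg m * (zee m)%:R).

Definition Qk n (k : nat) : Lam n :=
  \sum_(m : 'X_{1..n < k.+1} | pwt m == k) (alpha ^+ mdeg m * (zee m)%:R)^-1 *: 'X_[m].

Definition qp n (la : seq nat) : Lam n := \prod_(k <- la) Qk n k.

Definition Qnorm n (f : Lam n) : Lam n := (sprod f f)^-1 *: f.

(* Realisation in n variables x_1..x_n: p_k |-> sum_j x_j^k.        *)
Definition toX n (f : Lam n) : {mpoly F[n]} :=
  f \mPo [tuple \sum_(j < n) 'X_j ^+ i.+1 | i < n].

Definition part_of n (e : 'X_{1..n}) : seq nat :=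
  sort geq (filter (fun x => 0 < x)%N (val (val e))).

Definition mono n (mu : seq nat) : {mpoly F[n]} :=
  \sum_(e : 'X_{1..n < n.+1} | part_of e == mu) 'X_[e].

Definition parts n : seq (seq nat) :=
  [seq part_of (val e) | e <- enum [pred e : 'X_{1..n < n.+1} | (mdeg e == n) && sorted geq (val (val (val e)))]].

Definition jackP_family n (P : seq nat -> Lam n) : Prop :=
  (forall mu, is_part mu -> sumn mu = n ->
     exists c : seq nat -> F,
       toX (P mu) = mono n mu
         + \sum_(nu <- parts n | dom_le nu mu && (nu != mu)) c nu *: mono n nu)
  /\ (forall mu nu, is_part mu -> sumn mu = n -> is_part nu -> sumn nu = n ->
        mu != nu -> sprod (P mu) (P nu) = 0).

(* Main.v *)
Require Import Defs.
From HB Require Import structures.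
From mathcomp Require Import all_boot all_order all_algebra.
From mathcomp Require Import fraction mpoly.
From mathcomp Require Import ring zify.
Import Order.TTheory GRing.Theory Num.Theory.
Local Open Scope ring_scope.

Set Implicit Arguments.
Unset Strict Implicit.
Unset Printing Implicit Defensive.

(** Let D be the Laplace-Beltrami operator in the power sums. It is self-adjoint,
    and acts on products of the Q_k by D q_nu = sum_mu r_(nu,mu) q_mu, which is
    triangular for the dominance order. Since <f, q_mu> is the coefficient of
    x^mu in f, the triangularity of P_la says that <P_la, q_mu> = delta_(la,mu)
    for mu >= la. Hence D Q_la - e'_la Q_la, which lies in the span of the q_mu
    with mu >= la, is orthogonal to that span; the scalar product being
    anisotropic (a sum of squares with positive weights in the formally real
    field Q(alpha)), it vanishes. The same pairing shows that these q_mu are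
    linearly independent and that the coefficient of q_la in Q_la is 1, so the
    coordinates of Q_la form the eigenvector of the triangular matrix M_la with
    first entry 1, which the determinant computes. *)

(** * Positive cones *)

(** Eigenvalues alone do not identify Q_la: e' takes the same value on (4,1,1) and (3,3). So e' is
    compared only along mu > la, where the sum of the squared parts grows strictly and alpha is
    transcendental. The eigenvector property comes from the pairing instead: <D Q_la, q_mu> = <Q_la,
    D q_mu>, D q_mu involves only q_nu with nu >= mu, and Q_la pairs to zero with all of these
    except q_la. Hence D Q_la and e'_la Q_la both pair to zero with q_mu unless mu = la, where the
    diagonal coefficient of D q_la is e'_la. The combinatorial obstacle is that r_(la,mu) is read
    off from one chosen triple (i, j, k), whereas D q_la has one term for every triple. All triples
    with the same result share la_i, la_j and k, and counting them yields the multiplicity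
    factor. *)

Record cone (R : idomainType) (pos : R -> Prop) : Prop := Cone {
  cone_neq0 : forall x, pos x -> x != 0;
  coneD : forall x y, pos x -> pos y -> pos (x + y);
  coneM : forall x y, pos x -> pos y -> pos (x * y);
  cone_sqr : forall x, x != 0 -> pos (x * x) }.

Lemma cone1 (R : idomainType) (pos : R -> Prop) : cone pos -> pos 1.
Proof. by move=> c; rewrite -[1]mulr1; apply: (cone_sqr c); apply: oner_neq0. Qed.

Lemma cone_nat (R : idomainType) (pos : R -> Prop) :
  cone pos -> forall k, (0 < k)%N -> pos k%:R.
Proof.
move=> c [//|k] _; elim: k => [|k IHk]; first exact: cone1.
by rewrite -natr1; exact: coneD IHk (cone1 c).
Qed.

Lemma cone_exp (R : idomainType) (pos : R -> Prop) (x : R) :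
  cone pos -> pos x -> forall k, pos (x ^+ k).
Proof.
move=> c px; elim=> [|k IHk]; first by rewrite expr0; apply: cone1.
by rewrite exprS; apply: coneM.
Qed.

Lemma cone_sum_sqr (R : idomainType) (pos : R -> Prop) (T : eqType) (s : seq T)
    (x w : T -> R) :
  cone pos -> (forall t, pos (w t)) ->
  \sum_(t <- s) x t * x t * w t = 0 -> forall t, t \in s -> x t = 0.
Proof.
move=> c pw.
(* A partial sum is zero or in the cone, so it can never cancel a nonzero term. *)
have nn (r : seq T) : \sum_(t <- r) x t * x t * w t = 0 \/
                      pos (\sum_(t <- r) x t * x t * w t).
  elim: r => [|t r IHr]; first by rewrite big_nil; left.
  rewrite big_cons; have [->|xt0] := eqVneq (x t) 0; first by rewrite !mul0r add0r.
  have pt : pos (x t * x t * w t) by apply: (coneM c (cone_sqr c xt0)).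
  by right; case: IHr => [->|pr]; rewrite ?addr0 //; apply: coneD.
elim: s => [//|t s IHs]; rewrite big_cons => e0 u.
have [xt0|xt0] := eqVneq (x t) 0.
  by move: e0; rewrite xt0 !mul0r add0r inE => /IHs h /predU1P[->|/h].
have pt : pos (x t * x t * w t) by apply: (coneM c (cone_sqr c xt0)).
case: (nn s) e0 => [->|ps /eqP]; last by rewrite (negPf (cone_neq0 c (coneD c pt ps))).
by rewrite addr0 => /eqP; rewrite (negPf (cone_neq0 c pt)).
Qed.

Lemma fracP (R : idomainType) (x : {fraction R}) :
  exists p q : R, q != 0 /\ x = FracField.tofrac p / FracField.tofrac q.
Proof.
elim/quotW: x => r; exists (frac r).1, (frac r).2.
have d0 := denom_ratioP r; split=> //.
apply: (canRL (mulfK _)); first by rewrite tofrac_eq0.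
unlock FracField.tofrac; rewrite -[LHS]FracField.pi_mul; apply/eqmodP.
rewrite /= /FracField.equivf /= /FracField.mulf.
by rewrite !numden_Ratio ?mulf_neq0 ?oner_eq0 // !mulr1 mulrC.
Qed.

(** Any representative with both parts in the cone counts, so a nonzero square p^2/q^2 qualifies
    without normalising signs. *)
Definition frac_pos (R : idomainType) (pos : R -> Prop) (x : {fraction R}) : Prop :=
  exists p q : R, [/\ pos p, pos q & x = FracField.tofrac p / FracField.tofrac q].

Lemma frac_cone (R : idomainType) (pos : R -> Prop) :
  cone pos -> cone (frac_pos pos).
Proof.
move=> c; have pos0 p : pos p -> FracField.tofrac p != 0.
  by rewrite tofrac_eq0; apply: cone_neq0.
split=> [x [p [q [/pos0 hp /pos0 hq ->]]]||x y|x x0].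
- by rewrite mulf_neq0 ?invr_neq0.
- move=> x y [p [q [hp hq ->]]] [p' [q' [hp' hq' ->]]].
  exists (p * q' + p' * q), (q * q').
  split; [apply: coneD => // | |]; try exact: coneM.
  by rewrite tofracD !tofracM addf_div // pos0.
- case=> p [q [hp hq ->]] [p' [q' [hp' hq' ->]]].
  by exists (p * p'), (q * q'); split; try exact: coneM; rewrite !tofracM mulf_div.
have [p [q [q0 ex]]] := fracP x.
exists (p * p), (q * q); rewrite ex mulf_div !tofracM.
split=> //; apply: cone_sqr => //.
by apply: contraNneq x0 => p0; rewrite ex p0 tofrac0 mul0r.
Qed.

(** This is positivity for large values of the variable, which makes alpha, and with it all weights
    of the scalar product, positive. *)
Lemma lead_coef_cone (R : realDomainType) :
  cone (fun p : {poly R} => 0 < lead_coef p).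
Proof.
split=> [p|p q|p q|p p0].
- by rewrite -lead_coef_eq0; case: ltgtP.
- wlog le_pq : p q / (size p <= size q)%N => [wl hp hq|].
    by case: (leqP (size p) (size q)) => [|/ltnW] h; [|rewrite addrC]; apply: wl.
  move=> hp hq; move: le_pq; rewrite leq_eqVlt => /orP[/eqP eq_pq|lt_pq].
    2: by rewrite lead_coefDr.
  (* For equal sizes the two positive leading coefficients cannot cancel, so the size does not
     drop. *)
  have c_gt0 : 0 < (p + q)`_(size q).-1.
    by rewrite coefD -{1}eq_pq; apply: addr_gt0.
  suff -> : lead_coef (p + q) = (p + q)`_(size q).-1 by [].
  rewrite lead_coefE; congr (_ `_ _.-1); apply/eqP; rewrite eqn_leq.
  rewrite (leq_trans (size_polyD _ _)) ?geq_max ?eq_pq ?leqnn //=.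
  have q_gt0 : (0 < size q)%N.
    by rewrite size_poly_gt0 -lead_coef_eq0; case: ltgtP hq.
  rewrite -(prednK q_gt0) ltnNge; apply/negP => /leq_sizeP/(_ _ (leqnn _)) e.
  by rewrite e ltxx in c_gt0.
- by rewrite lead_coefM; apply: mulr_gt0.
by rewrite lead_coefM lt_def mulf_neq0 ?lead_coef_eq0 //= -expr2 sqr_ge0.
Qed.

(** * The scalar product *)

(* The definitions on [F] are restated over a field [K] with parameter [a]: with
   the concrete [F], unification unfolds the field of fractions and diverges. At
   [K := F] and [a := alpha] they are convertible to the original ones. *)
Section JackProduct.
Variables (K : fieldType) (a : K) (n : nat).

Definition wgt (m : 'X_{1..n}) : K := a ^+ mdeg m * (zee m)%:R.

Definition jprod (f g : {mpoly K[n]}) : K :=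
  \sum_(m <- msupp f) f@_m * g@_m * (a ^+ mdeg m * (zee m)%:R).

Definition Qg (k : nat) : {mpoly K[n]} :=
  \sum_(m : 'X_{1..n < k.+1} | pwt m == k) (a ^+ mdeg m * (zee m)%:R)^-1 *: 'X_[m].

Definition qg (la : seq nat) : {mpoly K[n]} := \prod_(k <- la) Qg k.

(** The definition sums over the support of [f] alone; summing over a list common to both arguments
    makes the symmetry visible. *)
Lemma jprodE (s : seq 'X_{1..n}) (f g : {mpoly K[n]}) :
  uniq s -> {subset msupp f <= s} -> jprod f g = \sum_(m <- s) f@_m * g@_m * wgt m.
Proof.
move=> us sub; rewrite [RHS](bigID (mem (msupp f))) /= [X in _ + X]big1 ?addr0 => [|m].
  rewrite -big_filter; apply: perm_big; apply: uniq_perm => [||m]; rewrite ?filter_uniq //.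
  by rewrite mem_filter; case: (boolP (m \in _)) => // /sub ->.
by rewrite -mcoeff_eq0 => /eqP ->; rewrite !mul0r.
Qed.

Lemma jprodC f g : jprod f g = jprod g f.
Proof.
pose s := undup (msupp f ++ msupp g).
rewrite !(@jprodE s) ?undup_uniq //.
- by apply: eq_bigr => m _; rewrite [f@_m * _]mulrC.
- by move=> m; rewrite mem_undup mem_cat orbC => ->.
by move=> m; rewrite mem_undup mem_cat => ->.
Qed.

Lemma jprod_is_linear f : linear (jprod f : {mpoly K[n]} -> K^o).
Proof.
move=> c g h; rewrite /jprod scaler_sumr -big_split; apply: eq_bigr => m _ /=.
by rewrite mcoeffD mcoeffZ /GRing.scale /=; ring.
Qed.
HB.instance Definition _ f := GRing.isLinear.Build K {mpoly K[n]} K^o _ (jprod f) (jprod_is_linear f).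

Lemma jprod0r f : jprod f 0 = 0.
Proof. exact: linear0. Qed.

Lemma jprodZr c f g : jprod f (c *: g) = c * jprod f g.
Proof. exact: linearZ. Qed.

Lemma jprodZl c f g : jprod (c *: f) g = c * jprod f g.
Proof. by rewrite jprodC jprodZr jprodC. Qed.

Lemma jprodDr f g h : jprod f (g + h) = jprod f g + jprod f h.
Proof. exact: linearD. Qed.

Lemma jprodDl f g h : jprod (f + g) h = jprod f h + jprod g h.
Proof. by rewrite jprodC jprodDr !(jprodC h). Qed.

Lemma jprod_sumr (I : Type) (r : seq I) (P : pred I) f (g : I -> {mpoly K[n]}) :
  jprod f (\sum_(i <- r | P i) g i) = \sum_(i <- r | P i) jprod f (g i).
Proof. exact: linear_sum. Qed.

Lemma jprod_suml (I : Type) (r : seq I) (P : pred I) f (g : I -> {mpoly K[n]}) :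
  jprod (\sum_(i <- r | P i) g i) f = \sum_(i <- r | P i) jprod (g i) f.
Proof. by rewrite jprodC jprod_sumr; apply: eq_bigr => i _; rewrite jprodC. Qed.

Lemma jprodX m g : jprod 'X_[m] g = g@_m * wgt m.
Proof. by rewrite /jprod msuppX big_seq1 mcoeffX eqxx mul1r. Qed.

Lemma zee_gt0 (m : 'X_{1..n}) : (0 < zee m)%N.
Proof. by apply: prodn_gt0 => i; rewrite muln_gt0 expn_gt0 fact_gt0. Qed.

Lemma zeeDU (m : 'X_{1..n}) (i : 'I_n) : zee (m + U_(i)) = (i.+1 * (m i).+1 * zee m)%N.
Proof.
rewrite /zee (bigD1 i) //= [X in (_ = _ * X)%N](bigD1 i) //=.
rewrite mnmDE mnm1E eqxx addn1 expnS factS.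
have -> : (\prod_(j < n | j != i) (j.+1 ^ (m + U_(i))%MM j * ((m + U_(i))%MM j)`!) =
  \prod_(j < n | j != i) (j.+1 ^ m j * (m j)`!))%N.
  by apply: eq_bigr => j /negPf ji; rewrite mnmDE mnm1E eq_sym ji addn0.
by rewrite !mulnA; congr (_ * _)%N; rewrite -!mulnA; congr (_ * _)%N; rewrite mulnCA.
Qed.

Lemma wgtDU m i : wgt (m + U_(i)) = a * i.+1%:R * (m i).+1%:R * wgt m.
Proof. by rewrite /wgt mdegD mdeg1 addn1 exprS zeeDU !natrM; ring. Qed.

Lemma pwtDU (m : 'X_{1..n}) (i : 'I_n) : pwt (m + U_(i)) = (pwt m + i.+1)%N.
Proof.
rewrite /pwt; under eq_bigr do rewrite mnmDE mulnDr.
rewrite big_split /=; congr (_ + _)%N; rewrite (bigD1 i) //= big1 => [|j /negPf ji].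
  by rewrite mnm1E eqxx muln1 addn0.
by rewrite mnm1E eq_sym ji muln0.
Qed.

(** Raising the exponent of p_(i+1) from m_i to m_i + 1 multiplies the weight by alpha (i+1) (m_i +
    1), and the last factor is the one produced by the derivative. *)
Lemma jprod_adj i f g : jprod ('X_i * f) g = a * i.+1%:R * jprod f g^`M(i).
Proof.
elim/mpolyind: f => [|c m f _ _ IHf]; first by rewrite mulr0 !(jprodC 0) !linear0 mulr0.
rewrite mulrDr !jprodDl IHf mulrDr; congr (_ + _).
rewrite -scalerAr -mpolyXD !jprodZl !jprodX addmC wgtDU mcoeff_deriv -mulr_natr; ring.
Qed.

Lemma leq_mdeg_pwt (m : 'X_{1..n}) : (mdeg m <= pwt m)%N.
Proof. by rewrite mdegE; apply: leq_sum => i _; rewrite leq_pmull. Qed.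

Lemma mcoeffQ k m : (Qg k)@_m = (pwt m == k)%:R * (wgt m)^-1.
Proof.
rewrite /Qg raddf_sum /=; have [e|ne] := eqVneq (pwt m) k; last first.
  rewrite mul0r big1 // => m' /eqP e; rewrite mcoeffZ mcoeffX.
  case: (eqVneq (m' : 'X_{1..n}) m) => [em|]; last by rewrite mulr0.
  by rewrite -em e eqxx in ne.
(* The degree is at most the weight, so the degree bound in [Qg] discards no monomial of weight
   k. *)
have lt_m : (mdeg m < k.+1)%N by rewrite ltnS -e leq_mdeg_pwt.
rewrite (bigD1 (BMultinom lt_m)) /= ?e // mcoeffZ mcoeffX eqxx mulr1 mul1r big1 ?addr0 //.
move=> m' /andP[_ ne]; rewrite mcoeffZ mcoeffX -[m]/(bmnm (BMultinom lt_m)).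
by rewrite (inj_eq val_inj) (negPf ne) mulr0.
Qed.

Lemma pwt0 : pwt (0 : 'X_{1..n})%MM = 0%N.
Proof. by rewrite /pwt big1 // => i _; rewrite mnm0E muln0. Qed.

Lemma wgt0 : wgt 0%MM = 1.
Proof. by rewrite /wgt mdeg0 mul1r /zee big1 // => i _; rewrite mnm0E. Qed.

Lemma Qg0 : Qg 0 = 1.
Proof.
apply/mpolyP=> m; rewrite mcoeffQ mcoeff1.
have [->|m0] := eqVneq m 0%MM; first by rewrite pwt0 wgt0 mul1r invr1.
have := leq_mdeg_pwt m; case: (pwt m) => [|k]; last by rewrite mul0r.
by rewrite leqn0 mdeg_eq0 (negPf m0).
Qed.

Hypothesis a0 : a != 0.
Hypothesis char0 : forall k, k.+1%:R != 0 :> K.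

Lemma wgt_neq0 m : wgt m != 0.
Proof. by rewrite mulf_neq0 ?expf_neq0 // -(prednK (zee_gt0 m)). Qed.

(** Q_(b-k) with Q_m = 0 for m < 0; truncated subtraction would give Q_0 = 1 there. *)
Definition Qsub (b k : nat) : {mpoly K[n]} := if (k <= b)%N then Qg (b - k) else 0.

(** The generating series of the Q_b is exp(sum_k p_k t^k / (alpha k)); differentiating in p_k
    multiplies it by t^k / (alpha k). *)
Lemma derivQ i b : (Qg b)^`M(i) = (a * i.+1%:R)^-1 *: Qsub b i.+1.
Proof.
apply/mpolyP=> m; rewrite mcoeff_deriv mcoeffZ mcoeffQ pwtDU wgtDU -[LHS]mulr_natr.
have -> : (Qsub b i.+1)@_m = ((pwt m + i.+1)%N == b)%:R * (wgt m)^-1.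
  rewrite /Qsub; case: ifP => h.
    by rewrite mcoeffQ -[in RHS](subnK h) eqn_add2r.
  by rewrite mcoeff0; case: eqP => [e|_]; [rewrite -e leq_addl in h | rewrite mul0r].
have := char0 i; have := char0 (m i); have := wgt_neq0 m.
move: i.+1%:R (m i).+1%:R (wgt m) (_ == _)%:R => x y w t w0 y0 x0.
by field; rewrite a0 w0 x0 y0.
Qed.
End JackProduct.

(** * The Laplace-Beltrami operator *)

(** The value k arises as i + j + 1 from exactly k pairs; the vanishing of [h] from [n] on removes
    the effect of the bounds on i and j. *)
Lemma sum_antidiag (V : nmodType) (n : nat) (h : nat -> V) :
  (forall k, (n <= k)%N -> h k = 0) ->
  \sum_(i < n) \sum_(j < n) h (i + j).+1 = \sum_(k < n) h k *+ k.
Proof.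
move=> h0.
have step (i : 'I_n) : \sum_(j < n) h (i + j).+1 = \sum_(k < n | (i < k)%N) h k.
  transitivity (\sum_(i.+1 <= k < n + i.+1) h k).
    rewrite -[X in \sum_(X <= _ < _) _]add0n big_addn addnK big_mkord.
    by apply: eq_bigr => j _; rewrite addnS addnC.
  rewrite (@big_cat_nat _ _ _ n) ?ltn_ord //= ?leq_addr // [X in _ + X]big_nat_cond.
  rewrite [X in _ + X]big1 ?addr0 => [|k /andP[/andP[/h0]]//].
  rewrite (big_nat_widenl _ 0) // big_mkord; exact: eq_bigl.
rewrite (eq_bigr _ (fun i _ => step i)) (exchange_big_dep predT) //=.
apply: eq_bigr => k _; rewrite sumr_const; congr (_ *+ _).
rewrite -sum1_card; transitivity (\sum_(i < n | (i < k)%N) 1)%N; first exact: eq_bigl.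
by rewrite -(big_ord_widen n (fun=> 1%N) (ltnW (ltn_ord k))) sum1_card card_ord.
Qed.

Section LaplaceBeltrami.
Variables (K : fieldType) (a : K) (n : nat).
Notation L := {mpoly K[n]}.
Notation Q := (Qg a n).
Notation Qs := (Qsub a n).

(** The index is an arbitrary natural number, with value 0 outside 1..n, because the double sums
    below reach p_(i+j) with i + j > n; likewise for [pder]. *)
Definition psum (k : nat) : L := \sum_(i < n | i.+1 == k) 'X_i.

Definition pder (k : nat) (f : L) : L := \sum_(i < n | i.+1 == k) f^`M(i).

Lemma psumS (i : 'I_n) : psum i.+1 = 'X_i.
Proof. by rewrite /psum (big_pred1 i) // => j; rewrite /= eqSS. Qed.

Lemma psum_gt k : (n < k)%N -> psum k = 0.
Proof.
move=> lt_nk; rewrite /psum big_pred0 // => i.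
by rewrite ltn_eqF // (leq_ltn_trans (ltn_ord i)).
Qed.

Lemma pder_is_linear k : linear (pder k).
Proof.
move=> c f g; rewrite /pder scaler_sumr -big_split.
by apply: eq_bigr => i _; rewrite linearP.
Qed.
HB.instance Definition _ k := GRing.isLinear.Build K L L _ (pder k) (pder_is_linear k).

Lemma pderM k f g : pder k (f * g) = pder k f * g + f * pder k g.
Proof.
rewrite /pder mulr_suml mulr_sumr -big_split.
by apply: eq_bigr => i _; rewrite mderivM.
Qed.

Lemma jprod_psum k f g : jprod a (psum k * f) g = a * k%:R * jprod a f (pder k g).
Proof.
rewrite mulr_suml jprod_suml jprod_sumr mulr_sumr.
by apply: eq_bigr => i /eqP <-; rewrite jprod_adj.
Qed.

(* The three parts of [2 D], where [D] is the Laplace-Beltrami operator having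
   [P_mu] as eigenvector with eigenvalue [e'_mu]. *)
Definition LBsplit (f : L) : L := a *: \sum_(i < n) \sum_(j < n)
  (i.+1%:R * j.+1%:R) *: (psum (i + j).+2 * f^`M(i)^`M(j)).

Definition LBjoin (f : L) : L := \sum_(i < n) \sum_(j < n)
  (i + j).+2%:R *: ('X_i * ('X_j * pder (i + j).+2 f)).

Definition LBdiag (f : L) : L := \sum_(i < n)
  (((a - 1) * i.+1%:R - 1) * i.+1%:R) *: ('X_i * f^`M(i)).

Definition LB f := LBsplit f + LBjoin f + LBdiag f.

(* The polarisation of the second-order part of [LB]. *)
Definition LBpol (f g : L) : L := a *: \sum_(i < n) \sum_(j < n)
  (i.+1%:R * j.+1%:R) *: (psum (i + j).+2 * (f^`M(i) * g^`M(j))).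

Lemma LB_is_linear : linear LB.
Proof.
move=> c f g; rewrite /LB /LBsplit /LBjoin /LBdiag.
have e1 : \sum_(i < n) \sum_(j < n)
    (i.+1%:R * j.+1%:R) *: (psum (i + j).+2 * (c *: f + g)^`M(i)^`M(j)) =
    c *: (\sum_(i < n) \sum_(j < n)
    (i.+1%:R * j.+1%:R) *: (psum (i + j).+2 * f^`M(i)^`M(j))) +
    \sum_(i < n) \sum_(j < n)
    (i.+1%:R * j.+1%:R) *: (psum (i + j).+2 * g^`M(i)^`M(j)).
  rewrite scaler_sumr -big_split; apply: eq_bigr => i _ /=.
  rewrite scaler_sumr -big_split; apply: eq_bigr => j _ /=.
  by rewrite !linearP /= mulrDr scalerDr -scalerAr !scalerA [c * _]mulrC.
have e2 : \sum_(i < n) \sum_(j < n)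
    (i + j).+2%:R *: ('X_i * ('X_j * pder (i + j).+2 (c *: f + g))) =
    c *: (\sum_(i < n) \sum_(j < n)
    (i + j).+2%:R *: ('X_i * ('X_j * pder (i + j).+2 f))) +
    \sum_(i < n) \sum_(j < n)
    (i + j).+2%:R *: ('X_i * ('X_j * pder (i + j).+2 g)).
  rewrite scaler_sumr -big_split; apply: eq_bigr => i _ /=.
  rewrite scaler_sumr -big_split; apply: eq_bigr => j _ /=.
  by rewrite !linearP /= !mulrDr scalerDr -!scalerAr !scalerA [c * _]mulrC.
have e3 : \sum_(i < n) (((a - 1) * i.+1%:R - 1) * i.+1%:R) *:
      ('X_i * (c *: f + g)^`M(i)) =
    c *: (\sum_(i < n) (((a - 1) * i.+1%:R - 1) * i.+1%:R) *: ('X_i * f^`M(i))) +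
    \sum_(i < n) (((a - 1) * i.+1%:R - 1) * i.+1%:R) *: ('X_i * g^`M(i)).
  rewrite scaler_sumr -big_split; apply: eq_bigr => i _ /=.
  by rewrite !linearP /= !mulrDr scalerDr -!scalerAr !scalerA [c * _]mulrC.
by rewrite e1 e2 e3 -!mul_mpolyC; ring.
Qed.
HB.instance Definition _ := GRing.isLinear.Build K L L _ LB LB_is_linear.

Lemma LBZ c f : LB (c *: f) = c *: LB f.
Proof. exact: linearZ. Qed.

Lemma LB_sum (I : Type) (r : seq I) (P : pred I) (f : I -> L) :
  LB (\sum_(i <- r | P i) f i) = \sum_(i <- r | P i) LB (f i).
Proof. exact: linear_sum. Qed.

(** Trading each p_k for its adjoint alpha k d/dp_k turns both sides into the same sum, with
    coefficients alpha^2 i j (i+j). *)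
Lemma jprod_split_join f g : jprod a (LBsplit f) g = jprod a f (LBjoin g).
Proof.
rewrite /LBsplit /LBjoin jprodZl jprod_suml jprod_sumr mulr_sumr.
apply: eq_bigr => i _; rewrite jprod_suml jprod_sumr mulr_sumr.
apply: eq_bigr => j _; rewrite jprodZl jprodZr jprod_psum.
by rewrite (jprodC _ f) !jprod_adj (jprodC _ (pder _ g)); ring.
Qed.

Lemma jprod_diag f g : jprod a (LBdiag f) g = jprod a f (LBdiag g).
Proof.
rewrite /LBdiag jprod_suml jprod_sumr; apply: eq_bigr => i _.
by rewrite jprodZl jprodZr jprod_adj (jprodC _ f) jprod_adj jprodC.
Qed.

Lemma jprod_LB f g : jprod a (LB f) g = jprod a f (LB g).
Proof.
rewrite /LB !jprodDl !jprodDr jprod_split_join jprod_diag; congr (_ + _).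
by rewrite addrC; congr (_ + _); rewrite jprodC -jprod_split_join jprodC.
Qed.

Lemma LBpolC f g : LBpol f g = LBpol g f.
Proof.
rewrite /LBpol exchange_big; congr (_ *: _).
apply: eq_bigr => i _; apply: eq_bigr => j _.
by rewrite [j.+1%:R * _]mulrC addnC [g^`M(_) * _]mulrC.
Qed.

Lemma LBpolM f g h : LBpol f (g * h) = LBpol f g * h + g * LBpol f h.
Proof.
rewrite /LBpol -scalerAl -scalerAr -scalerDr; congr (_ *: _).
rewrite mulr_suml mulr_sumr -big_split; apply: eq_bigr => i _ /=.
rewrite mulr_suml mulr_sumr -big_split; apply: eq_bigr => j _ /=.
rewrite -scalerAl -scalerAr -scalerDr; congr (_ *: _).
by rewrite mderivM; ring.
Qed.

Lemma LBpol1 f : LBpol f 1 = 0.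
Proof.
rewrite /LBpol big1 ?scaler0 // => i _; rewrite big1 // => j _.
by rewrite -mpolyC1 mderivC !mulr0 scaler0.
Qed.

Lemma LBsplitM f g :
  LBsplit (f * g) = LBsplit f * g + f * LBsplit g + LBpol f g *+ 2.
Proof.
rewrite mulr2n {2}LBpolC /LBsplit /LBpol -scalerAl -scalerAr -!scalerDr; congr (_ *: _).
rewrite mulr_suml mulr_sumr -!big_split; apply: eq_bigr => i _ /=.
rewrite mulr_suml mulr_sumr -!big_split; apply: eq_bigr => j _ /=.
rewrite -scalerAl -scalerAr -!scalerDr; congr (_ *: _).
by rewrite !(mderivM, mderivD); ring.
Qed.

Lemma LBjoinM f g : LBjoin (f * g) = LBjoin f * g + f * LBjoin g.
Proof.
rewrite /LBjoin.
rewrite mulr_suml mulr_sumr -!big_split; apply: eq_bigr => i _ /=.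
rewrite mulr_suml mulr_sumr -!big_split; apply: eq_bigr => j _ /=.
by rewrite -scalerAl -scalerAr -!scalerDr pderM; congr (_ *: _); ring.
Qed.

Lemma LBdiagM f g : LBdiag (f * g) = LBdiag f * g + f * LBdiag g.
Proof.
rewrite /LBdiag mulr_suml mulr_sumr -!big_split; apply: eq_bigr => i _ /=.
by rewrite -scalerAl -scalerAr -!scalerDr mderivM; congr (_ *: _); ring.
Qed.

(** An operator of order two fails the Leibniz rule by its polarisation, itself a derivation in each
    argument. The action on products thus follows from that on single factors and on pairs. *)
Lemma LBM f g : LB (f * g) = LB f * g + f * LB g + LBpol f g *+ 2.
Proof. by rewrite /LB LBsplitM LBjoinM LBdiagM; ring. Qed.

Lemma LB1 : LB 1 = 0.
Proof.
rewrite /LB /LBsplit /LBjoin /LBdiag -mpolyC1.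
rewrite big1 => [|i _]; last by rewrite big1 // => j _; rewrite mderivC linear0 mulr0 scaler0.
rewrite big1 => [|i _]; last first.
  rewrite big1 // => j _; rewrite /pder big1 ?mulr0 ?scaler0 // => k _.
  by rewrite mderivC.
by rewrite big1 => [|i _]; rewrite ?scaler0 ?addr0 // mderivC mulr0 scaler0.
Qed.

Lemma euler_mcoeff (f : L) m :
  (\sum_(i < n) i.+1%:R *: ('X_i * f^`M(i)))@_m = (pwt m)%:R * f@_m.
Proof.
elim/mpolyind: f => [|c u f _ _ IHf].
  by rewrite big1 ?mcoeff0 ?mulr0 // => i _; rewrite mderiv0 mulr0 scaler0.
under eq_bigr => i _ do rewrite mderivD mderivZ mulrDr scalerDr.
rewrite big_split /= mcoeffD IHf mcoeffD mulrDr; congr (_ + _).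
rewrite raddf_sum mcoeffZ mcoeffX /=.
transitivity (\sum_(i < n) (i.+1 * u i)%:R * (c * (u == m)%:R)).
  apply: eq_bigr => i _; rewrite mderivX; have [e|u0] := eqVneq (u i) 0%N.
    by rewrite e muln0 mul0r scale0r scaler0 mulr0 scaler0 mcoeff0.
  rewrite -!scalerAr -mpolyXD addmC submK ?lep1mP // !mcoeffZ mcoeffX natrM; ring.
rewrite -mulr_suml -natr_sum -/(pwt u).
by case: eqVneq => [->//|_]; rewrite !mulr0.
Qed.
End LaplaceBeltrami.

(** * Action of the operator on single Q_k and on pairs of them *)

Section ActionOnQ.
Variables (K : fieldType) (a : K) (n : nat).
Hypothesis a0 : a != 0.
Hypothesis char0 : forall k, k.+1%:R != 0 :> K.
Notation L := {mpoly K[n]}.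
Notation Q := (Qg a n).
Notation Qs := (Qsub a n).
Notation psum := (psum K n).

Lemma Qsub_gt b k : (b < k)%N -> Qs b k = 0.
Proof. by move=> bk; rewrite /Qsub leqNgt bk. Qed.

Lemma QsubSS b k : Qs b.+1 k.+1 = Qs b k.
Proof. by rewrite /Qsub ltnS subSS. Qed.

Lemma Qsub0 b : Qs b 0 = Q b.
Proof. by rewrite /Qsub subn0. Qed.

Lemma Qsub_sub b k i : (k <= b)%N -> Qs (b - k) i = Qs b (k + i).
Proof. by move=> kb; rewrite /Qsub -leq_subRL // subnDA. Qed.

Lemma deriv_Qsub i b k : (Qs b k)^`M(i) = (a * i.+1%:R)^-1 *: Qs b (k + i.+1).
Proof.
rewrite {1}/Qsub; case: ifP => kb; first by rewrite derivQ // Qsub_sub.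
rewrite linear0 Qsub_gt ?scaler0 //; apply: ltn_addr; rewrite ltnNge kb //.
Qed.

Lemma pder_Q k b : (0 < k <= n)%N -> pder k (Q b) = (a * k%:R)^-1 *: Qs b k.
Proof.
case: k => [//|k] /= kn; rewrite /pder (big_pred1 (Ordinal kn)) ?derivQ //.
Qed.

(** Euler's identity for the weighted homogeneous Q_b, with its derivatives replaced through
    [derivQ]. *)
Lemma newton b : \sum_(i < n) 'X_i * Qs b i.+1 = (a * b%:R) *: Q b.
Proof.
rewrite -scalerA; apply: (scalerI (invr_neq0 a0)).
rewrite [RHS]scalerA mulVf // scale1r.
apply/mpolyP => m; rewrite [RHS]mcoeffZ.
transitivity ((pwt m)%:R * (Q b)@_m).
  rewrite -euler_mcoeff scaler_sumr; congr (_@__); apply: eq_bigr => i _.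
  rewrite derivQ // -!scalerAr scalerA; congr (_ *: _).
  by have := char0 i; move: i.+1%:R => x x0; field; rewrite ?a0 ?x0.
by rewrite mcoeffQ; case: eqVneq => [->//|_]; rewrite mul0r !mulr0.
Qed.

Lemma newton_psum N b : (n <= N)%N ->
  \sum_(i < N) psum i.+1 * Qs b i.+1 = (a * b%:R) *: Q b.
Proof.
move=> nN; rewrite -newton -(subnKC nN) big_split_ord /= [X in _ + X]big1 ?addr0 => [|i _].
  by apply: eq_bigr => i _; rewrite psumS.
by rewrite psum_gt ?mul0r // ltnS leq_addr.
Qed.

Definition Qconv (b c : nat) : L :=
  \sum_(i < n) \sum_(j < n) psum (i + j).+2 * (Qs b i.+1 * Qs c j.+1).

Lemma LBpol_Q b c : LBpol a (Q b) (Q c) = a^-1 *: Qconv b c.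
Proof.
rewrite /LBpol /Qconv !scaler_sumr; apply: eq_bigr => i _.
rewrite !scaler_sumr; apply: eq_bigr => j _.
rewrite !derivQ // -!mul_mpolyC !mulrA; set x := psum _; set y := Qs _ _; set z := Qs _ _.
have -> : a^-1 = a * (i.+1%:R * j.+1%:R) * (a * i.+1%:R)^-1 * (a * j.+1%:R)^-1.
  have := char0 i; have := char0 j; move: i.+1%:R j.+1%:R => u v u0 v0.
  by field; rewrite ?a0 ?u0 ?v0.
rewrite !mpolyCM; ring.
Qed.

Lemma QconvC b c : Qconv b c = Qconv c b.
Proof.
rewrite /Qconv exchange_big; apply: eq_bigr => i _; apply: eq_bigr => j _.
by rewrite addnC [Qs b _ * _]mulrC.
Qed.

Lemma Qconv0 b : Qconv b 0 = 0.
Proof.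
by rewrite /Qconv big1 // => i _; rewrite big1 // => j _; rewrite [Qs 0 _]Qsub_gt ?mulr0.
Qed.

(** What remains of Q-convolution (b, c+1) once Newton's identity has evaluated the terms j = 1. Its
    symmetry in b and c makes the difference between (b, c+1) and (b+1, c) explicit. *)
Let mid b c := \sum_(i < n) \sum_(j < n) psum (i + j).+3 * (Qs b i.+1 * Qs c j.+1).

Let midC b c : mid b c = mid c b.
Proof.
rewrite /mid exchange_big; apply: eq_bigr => i _; apply: eq_bigr => j _.
by rewrite addnC [Qs b _ * _]mulrC.
Qed.

Let QconvS b c : Qconv b c.+1 =
  ((a * b.+1%:R) *: Q b.+1 - psum 1 * Q b) * Q c + mid b c.
Proof.
have -> : (a * b.+1%:R) *: Q b.+1 - psum 1 * Q b = \sum_(i < n) psum i.+2 * Qs b i.+1.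
  rewrite -(newton_psum _ (leqnSn n)) big_ord_recl QsubSS Qsub0 addrC addKr.
  by apply: eq_bigr => i _; rewrite QsubSS.
rewrite mulr_suml /Qconv /mid -big_split; apply: eq_bigr => i _ /=.
transitivity (\sum_(j < n.+1) psum (i + j).+2 * (Qs b i.+1 * Qs c.+1 j.+1)).
  by rewrite big_ord_recr /= psum_gt ?mul0r ?addr0 // ltnS leqW // leq_addl.
rewrite big_ord_recl QsubSS Qsub0 addn0 -mulrA; congr (_ + _).
by apply: eq_bigr => j _; rewrite QsubSS /= /bump leq0n add1n addnS.
Qed.

Lemma Qconv_rec b c : Qconv b c.+1 =
  Qconv b.+1 c + (a * b.+1%:R) *: (Q b.+1 * Q c) - (a * c.+1%:R) *: (Q b * Q c.+1).
Proof.
rewrite (QconvC b.+1) !QconvS (midC c) -!mul_mpolyC; ring.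
Qed.

(** Iterating [Qconv_rec] moves units from c to b until c is 0. The product Q_(b+k) Q_(c-k) receives
    b+k from one step and -(c-k) from the next, whence b - c + 2k; at k = 0 only -c is left. *)
Lemma LBpol_QQ b c : LBpol a (Q b) (Q c) =
  \sum_(k < c) (b%:R - c%:R + 2%:R * k.+1%:R) *: (Q (b + k.+1) * Q (c - k.+1))
  - c%:R *: (Q b * Q c).
Proof.
rewrite LBpol_Q; elim: c b => [|c IHc] b.
  by rewrite Qconv0 big_ord0 scale0r subr0 scaler0.
rewrite Qconv_rec scalerBr scalerDr IHc !scalerA !mulrA mulVf // !mul1r.
rewrite big_ord_recl /= addn1 subn1 /=.
have -> : \sum_(k < c) (b%:R - c.+1%:R + 2%:R * (bump 0 k).+1%:R) *:
    (Q (b + (bump 0 k).+1) * Q (c.+1 - (bump 0 k).+1)) =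
  \sum_(k < c) (b.+1%:R - c%:R + 2%:R * k.+1%:R) *: (Q (b.+1 + k.+1) * Q (c - k.+1)).
  apply: eq_bigr => k _; rewrite /bump leq0n add1n subSS addnS addSn; congr (_ *: _).
  rewrite -!natr1; ring.
rewrite -!mul_mpolyC -[b.+1%:R]natr1 -[c.+1%:R]natr1 !(mpolyCD, mpolyCN, mpolyCM, mpolyC1).
ring.
Qed.

Lemma LBsplit_Q b : LBsplit a (Q b) =
  a^-1 *: \sum_(i < n) i%:R *: ('X_i * Qs b i.+1).
Proof.
transitivity (a^-1 *: \sum_(i < n) \sum_(j < n) psum (i + j).+2 * Qs b (i + j).+2).
  rewrite /LBsplit !scaler_sumr; apply: eq_bigr => i _.
  rewrite !scaler_sumr; apply: eq_bigr => j _.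
  rewrite derivQ // mderivZ deriv_Qsub addSn addnS -!mul_mpolyC !mulrA.
  have -> : a^-1 = a * (i.+1%:R * j.+1%:R) * (a * i.+1%:R)^-1 * (a * j.+1%:R)^-1.
    have := char0 i; have := char0 j; move: i.+1%:R j.+1%:R => u v u0 v0.
    by field; rewrite ?a0 ?u0 ?v0.
  rewrite !mpolyCM; ring.
congr (_ *: _); rewrite (@sum_antidiag _ _ (fun k => psum k.+1 * Qs b k.+1)).
  by apply: eq_bigr => i _; rewrite psumS scaler_nat.
by move=> k nk; rewrite psum_gt ?mul0r.
Qed.

Lemma LBjoin_Q b : (b <= n)%N -> LBjoin (Q b) =
  \sum_(i < n) (b%:R - i.+1%:R) *: ('X_i * Qs b i.+1).
Proof.
move=> bn; apply: eq_bigr => i _.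
transitivity (a^-1 *: ('X_i * (\sum_(j < n) 'X_j * Qs b (i.+1 + j.+1)))).
  rewrite mulr_sumr scaler_sumr; apply: eq_bigr => j _; rewrite addSn addnS.
  (* Beyond n the derivative is 0 by truncation, and so is the matching Q_(b-i-j-2), because b <=
     n. *)
  have [le_n|gt_n] := leqP (i + j).+2 n.
    rewrite pder_Q // -!scalerAr scalerA; congr (_ *: _).
    by have := char0 (i + j).+1; move: (i + j).+2%:R => x x0; field; rewrite ?a0 ?x0.
  rewrite Qsub_gt ?(leq_trans _ gt_n) ?ltnS // !mulr0 scaler0 /pder big_pred0.
    by rewrite !mulr0 scaler0.
  by move=> k; rewrite ltn_eqF // (leq_ltn_trans (ltn_ord k)).
have [ib|bi] := leqP i.+1 b; last first.
  rewrite (Qsub_gt bi) mulr0 scaler0 big1 ?mulr0 ?scaler0 // => j _.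
  by rewrite Qsub_gt ?mulr0 // ltn_addr.
under eq_bigr => j _ do rewrite -Qsub_sub //.
rewrite newton /Qsub ib -scalerAr scalerA -natrB // mulrA mulVf // mul1r //.
Qed.

(** The coefficients of the products p_i Q_(b-i) in the three parts add up to b - 2/alpha,
    independent of i, so Newton's identity applies; the coefficients of [LBdiag] achieve this
    cancellation. *)
Lemma LB_Q b : (b <= n)%N -> LB a (Q b) = ((a * b%:R - 2%:R) * b%:R) *: Q b.
Proof.
move=> bn; rewrite /LB LBsplit_Q LBjoin_Q // /LBdiag scaler_sumr -!big_split /=.
transitivity (\sum_(i < n) (b%:R - 2%:R / a) *: ('X_i * Qs b i.+1)).
  apply: eq_bigr => i _; rewrite derivQ // -scalerAr !scalerA -!scalerDl; congr (_ *: _).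
  have := char0 i; rewrite -natr1; move: i%:R => x x0; field; rewrite a0 //.
rewrite -scaler_sumr newton scalerA; congr (_ *: _); field; exact: a0.
Qed.
End ActionOnQ.

(** * Action of the operator on products of the Q_k *)

Definition raise_lower (la : seq nat) (i j k : nat) : seq nat :=
  set_nth 0%N (set_nth 0%N la i (nth 0 la i + k)%N) j (nth 0 la j - k)%N.

Section ActionOnProducts.
Variables (K : fieldType) (a : K) (n : nat).
Hypothesis a0 : a != 0.
Hypothesis char0 : forall k, k.+1%:R != 0 :> K.
Notation L := {mpoly K[n]}.
Notation Q := (Qg a n).
Notation q := (qg a n).

Lemma qg_cons b la : q (b :: la) = Q b * q la.
Proof. by rewrite /qg big_cons. Qed.

Lemma qg_nil : q [::] = 1.
Proof. by rewrite /qg big_nil. Qed.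

Lemma LBpol_Qq b la : LBpol a (Q b) (q la) =
  \sum_(j < size la) \sum_(k < nth 0 la j)
    (b%:R - (nth 0 la j)%:R + 2%:R * k.+1%:R) *:
      (Q (b + k.+1) * q (set_nth 0%N la j (nth 0 la j - k.+1)%N))
  - (sumn la)%:R *: (Q b * q la).
Proof.
elim: la => [|c la IHla].
  by rewrite qg_nil LBpol1 big_ord0 scale0r subr0.
rewrite qg_cons LBpolM LBpol_QQ // IHla big_ord_recl /= natrD.
set S1 := \sum_(k < c) _; set S2 := \sum_(j < size la) _.
set S1' := \sum_(k < c) _; set S2' := \sum_(j < size la) _.
have -> : S1' = S1 * q la.
  rewrite mulr_suml; apply: eq_bigr => k _.
  by rewrite qg_cons mulrA -scalerAl.
have -> : S2' = Q c * S2.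
  rewrite mulr_sumr; apply: eq_bigr => j _; rewrite mulr_sumr; apply: eq_bigr => k _.
  by rewrite qg_cons mulrCA -scalerAr.
rewrite -!mul_mpolyC mpolyCD; ring.
Qed.

Definition evLB (la : seq nat) : K :=
  2%:R^-1 * a * (\sum_(x <- la) x ^ 2)%N%:R
  - (\sum_(i < size la) (i.+1 * nth 0 la i))%N%:R.

(** A new first part pushes every other part one place down, which costs [sumn la]; this is the term
    left over in [LBpol_Qq]. *)
Lemma evLB_cons b la :
  2%:R * evLB (b :: la) = 2%:R * evLB la + (a * b%:R - 2%:R) * b%:R - 2%:R * (sumn la)%:R.
Proof.
have e : (\sum_(i < size (b :: la)) i.+1 * nth 0 (b :: la) i =
          b + (\sum_(i < size la) i.+1 * nth 0 la i + sumn la))%N.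
  rewrite /= big_ord_recl /= mul1n; congr (_ + _)%N.
  rewrite sumnE (big_nth 0%N) big_mkord -big_split /=; apply: eq_bigr => i _.
  by rewrite /bump leq0n add1n mulSn addnC.
rewrite /evLB e big_cons !natrD natrX.
by have := char0 1; move: 2%:R => x x0; field.
Qed.

Lemma LB_qg la : all (leq^~ n) la -> LB a (q la) =
  2%:R *: (evLB la *: q la + \sum_(i < size la) \sum_(j < size la | (i < j)%N)
    \sum_(k < nth 0 la j) ((nth 0 la i)%:R - (nth 0 la j)%:R + 2%:R * k.+1%:R) *:
      q (raise_lower la i j k.+1)).
Proof.
elim: la => [_|b la IHla /andP[bn /IHla e]].
  rewrite qg_nil LB1 big_ord0 addr0 scalerA /evLB big_nil big_ord0.
  by rewrite mulr0 subr0 mulr0 scale0r.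
rewrite qg_cons LBM LB_Q // LBpol_Qq e [in RHS]scalerDr [in RHS]scalerA evLB_cons big_ord_recl.
set S := \sum_(i < size la) _ in e *; set P := \sum_(j < size la) _.
rewrite /=; set P' := \sum_(j < _ | _) _; set S' := \sum_(i < _) _.
have -> : P' = P.
  rewrite /P' big_mkcond big_ord_recl /= add0r; apply: eq_bigr => j _.
  by apply: eq_bigr => k _; rewrite /raise_lower /= qg_cons.
have -> : S' = Q b * S.
  rewrite mulr_sumr; apply: eq_bigr => i _; rewrite big_mkcond big_ord_recl /= add0r.
  rewrite -big_mkcond mulr_sumr; apply: eq_big => // j _; rewrite mulr_sumr.
  by apply: eq_bigr => k _; rewrite -scalerAr -qg_cons.
rewrite -!mul_mpolyC -mulr_natr !(mpolyCD, mpolyCN, mpolyCM, mpolyC1); ring.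
Qed.
End ActionOnProducts.

(** * Partitions, dominance and moving up *)

Section Combinatorics.
Local Open Scope nat_scope.

Lemma geq_total : total geq. Proof. by move=> x y; apply: leq_total. Qed.
Lemma geq_trans : transitive geq. Proof. by move=> x y z xy yz; apply: leq_trans yz xy. Qed.
Lemma geq_anti : antisymmetric geq. Proof. by move=> x y /andP[xy yx]; apply/eqP; rewrite eqn_leq; apply/andP. Qed.

Lemma part_nth_geq la i j : is_part la -> i <= j -> nth 0 la j <= nth 0 la i.
Proof.
case/andP=> so _ ij; have [js|sj] := ltnP j (size la); last by rewrite nth_default.
exact: (sorted_leq_nth geq_trans leqnn 0 so) (leq_ltn_trans ij js) js ij.
Qed.

Lemma sum_nth (g : nat -> nat) (la : seq nat) N : g 0 = 0 -> size la <= N ->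
  \sum_(x <- la) g x = \sum_(i < N) g (nth 0 la i).
Proof.
move=> g0 sN; rewrite (big_nth 0) big_mkord (big_ord_widen _ (fun i => g (nth 0 la i)) sN).
rewrite big_mkcond; apply: eq_bigr => i _; case: ltnP => // h.
by rewrite nth_default.
Qed.

Lemma sumn_take (la : seq nat) k : sumn (take k la) = \sum_(i < k) nth 0 la i.
Proof.
rewrite sumnE (@sum_nth id _ k) // ?size_take; last by case: ltnP.
by apply: eq_bigr => i _; rewrite nth_take.
Qed.

Lemma part_eq la mu : is_part la -> is_part mu ->
  (forall i, nth 0 la i = nth 0 mu i) -> la = mu.
Proof.
move=> /andP[_ pl] /andP[_ pm] e; apply: (@eq_from_nth _ 0) => [|i _]; last exact: e.
case: (ltngtP (size la) (size mu)) => // h.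
- by have := all_nthP 0 pm _ h; rewrite -e nth_default.
by have := all_nthP 0 pl _ h; rewrite e nth_default.
Qed.

Lemma dom_leP la mu : reflect
  (sumn la = sumn mu /\ forall k, sumn (take k la) <= sumn (take k mu)) (dom_le la mu).
Proof.
apply: (iffP andP) => [[/eqP es /allP h]|[es h]]; split; rewrite ?es //; last first.
  by apply/allP => k _; apply: h.
move=> k; have [kl|lk] := leqP k (size la + size mu).
  by apply: h; rewrite mem_iota ltnS.
by rewrite !take_oversize ?es //; apply/ltnW/(leq_trans _ lk); rewrite ltnS ?leq_addl ?leq_addr.
Qed.

Lemma dom_le_refl la : dom_le la la.
Proof. exact/dom_leP. Qed.

Lemma dom_le_trans : transitive dom_le.
Proof.
move=> mu la nu /dom_leP[e1 h1] /dom_leP[e2 h2]; apply/dom_leP; split; first by rewrite e1.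
by move=> k; apply: leq_trans (h1 k) (h2 k).
Qed.

Lemma rlex_ltP la mu : reflect
  (exists2 i, nth 0 la i < nth 0 mu i & forall j, j < i -> nth 0 la j = nth 0 mu j)
  (rlex_lt la mu).
Proof.
apply: (iffP hasP) => [[i _ /andP[lt_i /allP h]]|[i lt_i h]]; exists i => //.
- by move=> j ji; apply/eqP/h; rewrite mem_iota.
- rewrite mem_iota add0n /=; case: (ltnP i (size mu)) => [im|mi]; first exact: ltn_addl.
  by move: lt_i; rewrite (nth_default _ mi).
by rewrite lt_i; apply/allP => j; rewrite mem_iota => /h ->.
Qed.

Lemma rlex_lt_irr la : rlex_lt la la = false.
Proof. by apply/negbTE/rlex_ltP => -[i]; rewrite ltnn. Qed.

Lemma rlex_lt_trans : transitive rlex_lt.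
Proof.
move=> mu la nu /rlex_ltP[i li hi] /rlex_ltP[j lj hj]; apply/rlex_ltP.
case: (ltngtP i j) => ij.
- by exists i => [|k ki]; [rewrite -hj | rewrite hi // hj // (ltn_trans ki)].
- by exists j => [|k kj]; [rewrite hi | rewrite -hj // hi // (ltn_trans kj)].
by exists i => [|k ki]; [rewrite (ltn_trans li) // ij | rewrite hi // hj // -ij].
Qed.

(** Up to the first index where the two differ the partial sums agree, so dominance decides the sign
    of the difference there. *)
Lemma dom_rlex la mu : is_part la -> is_part mu -> dom_le la mu -> la != mu ->
  rlex_lt la mu.
Proof.
move=> pl pm /dom_leP[_ h] ne.
have [i ne_i] : exists i, nth 0 la i != nth 0 mu i.
  pose N := size la + size mu.
  case: (pickP (fun i : 'I_N => nth 0 la i != nth 0 mu i)) => [i hi|no]; first by exists i.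
  case/eqP: ne; apply: part_eq => // i; have [iN|Ni] := ltnP i N.
    by have /negbFE/eqP := no (Ordinal iN).
  by rewrite !nth_default // (leq_trans _ Ni) // ?leq_addl ?leq_addr.
have ex : exists i, nth 0 la i != nth 0 mu i by exists i.
case: (ex_minnP ex) => m ne_m min_m; apply/rlex_ltP.
have eq_lt j : j < m -> nth 0 la j = nth 0 mu j.
  by move=> jm; apply/eqP; apply: contraLR jm => /min_m; rewrite -leqNgt.
exists m => //; have := h m.+1; rewrite !sumn_take !big_ord_recr /=.
rewrite (eq_bigr (fun i : 'I_m => nth 0 mu i)) => [|j _]; last exact: eq_lt.
by rewrite leq_add2l leq_eqVlt (negPf ne_m).
Qed.

(** Combines sum la_i^2 <= sum la_i mu_i with 2 sum la_i mu_i < sum la_i^2 + sum mu_i^2, which is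
    strict because some entries differ. *)
Lemma dom_sum_sqr_lt la mu : is_part la -> is_part mu -> dom_le la mu -> la != mu ->
  \sum_(x <- la) x ^ 2 < \sum_(x <- mu) x ^ 2.
Proof.
move=> pl pm dom ne; have /rlex_ltP[i0 lt_i0 _] := dom_rlex pl pm dom ne.
move/dom_leP: dom => [es h]; pose N := size la + size mu.
pose f := nth 0 la; pose g := nth 0 mu.
(* Abel summation, using that f decreases. The boundary terms stay on both sides to avoid
   subtraction, and vanish at k = N since f N = 0. *)
have abel k : \sum_(i < k) f i ^ 2 + f k * (\sum_(i < k) g i) <=
              \sum_(i < k) f i * g i + f k * (\sum_(i < k) f i).
  elim: k => [|k IHk]; first by rewrite !big_ord0.
  have := h k.+1; rewrite !sumn_take -/f -/g.
  have : f k.+1 <= f k by apply: part_nth_geq.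
  rewrite !big_ord_recr /=; move: IHk.
  move: (\sum_(i < k) f i ^ 2) (\sum_(i < k) f i * g i) (\sum_(i < k) f i) (\sum_(i < k) g i).
  move: (f k) (f k.+1) (g k) => x y z u v A B; nia.
have fN : f N = 0 by rewrite /f nth_default // leq_addr.
have iN : i0 < N.
  have [im|mi] := ltnP i0 (size mu); first exact: ltn_addl.
  by rewrite (nth_default _ mi) in lt_i0.
have := abel N; rewrite fN !addn0.
rewrite (@sum_nth (fun x => x ^ 2) la N) ?leq_addr //.
rewrite (@sum_nth (fun x => x ^ 2) mu N) ?leq_addl //.
suff : 2 * (\sum_(i < N) f i * g i) < \sum_(i < N) f i ^ 2 + \sum_(i < N) g i ^ 2.
  rewrite -/f -/g; lia.
rewrite -big_split big_distrr /= (bigD1 (Ordinal iN)) //= [X in _ < X](bigD1 (Ordinal iN)) //=.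
rewrite -addSn leq_add //; last by apply: leq_sum => i _; rewrite (nat_Cauchy _ _).
by rewrite (ltn_leqif (nat_Cauchy _ _)) ltn_eqF.
Qed.

Lemma sum_set_nth (g : nat -> nat) (s : seq nat) i y : i < size s ->
  \sum_(x <- set_nth 0 s i y) g x + g (nth 0 s i) = \sum_(x <- s) g x + g y.
Proof.
elim: s i => [//|z s IHs] [|i] /= h; rewrite !big_cons; first by lia.
by have := IHs i h; lia.
Qed.

Lemma sum_raise_lower (g : nat -> nat) (la : seq nat) i j k : i < j < size la ->
  \sum_(x <- raise_lower la i j k) g x + (g (nth 0 la i) + g (nth 0 la j)) =
  \sum_(x <- la) g x + (g (nth 0 la i + k) + g (nth 0 la j - k)).
Proof.
case/andP=> ij js; have is_ := ltn_trans ij js.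
have := sum_set_nth g (nth 0 la i + k) is_.
have := @sum_set_nth g (set_nth 0 la i (nth 0 la i + k)) j (nth 0 la j - k).
rewrite size_set_nth nth_set_nth /= gtn_eqF // => /(_ (leq_trans js (leq_maxr _ _))).
rewrite -/(raise_lower la i j k); lia.
Qed.

(** The test function g sees the multiset of parts without following the sort; g 0 = 0 accounts for
    the deleted zeros. Identity, square, truncation x - c and the indicator of a value give the
    size, the inequality with la, dominance and the multiplicities. *)
Lemma sum_moveup (g : nat -> nat) (la : seq nat) i j k : g 0 = 0 -> i < j < size la ->
  \sum_(x <- moveup la i j k) g x + (g (nth 0 la i) + g (nth 0 la j)) =
  \sum_(x <- la) g x + (g (nth 0 la i + k) + g (nth 0 la j - k)).
Proof.
move=> g0 ij; rewrite -sum_raise_lower //; congr (_ + _).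
rewrite /moveup -/(raise_lower la i j k) (perm_big _ (permEl (perm_sort _ _))) big_filter.
by rewrite big_mkcond; apply: eq_bigr => -[].
Qed.

Lemma part_moveup la i j k : is_part (moveup la i j k).
Proof.
by rewrite /is_part (sort_sorted geq_total) all_sort filter_all.
Qed.

Section Moveup.
Variables (la : seq nat) (i j k : nat).
Hypothesis part_la : is_part la.
Hypotheses (ij : i < j < size la) (k_gt0 : 0 < k) (kj : k <= nth 0 la j).

Let ge_ij : nth 0 la j <= nth 0 la i.
Proof. by apply: part_nth_geq => //; case/andP: ij => /ltnW. Qed.

Lemma moveup_neq : moveup la i j k != la.
Proof.
apply/eqP => e; have := @sum_moveup (fun x => x ^ 2) la i j k erefl ij; rewrite e.
move/eqP; rewrite eqn_add2l => /eqP; nia.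
Qed.

Lemma sumn_moveup : sumn (moveup la i j k) = sumn la.
Proof. by have := @sum_moveup id la i j k erefl ij; rewrite !sumnE; lia. Qed.

(** For a partition, the sum of the first m parts is the minimum over c of sum (x - c)^+ + m c,
    attained at c = the part of index m. Convexity of x -> (x - c)^+ makes the sum grow when two
    parts are spread apart. *)
Lemma dom_moveup : dom_le la (moveup la i j k).
Proof.
apply/dom_leP; split=> [|m]; first by rewrite sumn_moveup.
set mu := moveup la i j k; pose c := nth 0 mu m.
have le_trunc (s : seq nat) : sumn (take m s) <= \sum_(x <- s) (x - c) + m * c.
  move: c => c; elim: s m => [|x s IHs] [|l] //=; rewrite big_cons; have := IHs l; lia.
have eq_trunc : sumn (take m mu) = \sum_(x <- mu) (x - c) + m * c.
  have part_mu : is_part mu by apply: part_moveup.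
  have [ms|sm] := ltnP m (size mu); last first.
    rewrite /c nth_default // muln0 addn0 take_oversize // sumnE.
    by apply: eq_bigr => x _; rewrite subn0.
  rewrite sumn_take (@sum_nth (fun x => x - c) _ (size mu)) //.
  rewrite -(subnKC (ltnW ms)) big_split_ord /= [X in _ + X + _]big1 => [|l _]; last first.
    by apply/eqP; rewrite subn_eq0; apply: part_nth_geq => //; apply: leq_addr.
  rewrite addn0 -[m in m * c]card_ord -sum_nat_const -big_split /=.
  by apply: eq_bigr => l _; rewrite subnK //; apply: part_nth_geq => //; apply: ltnW.
rewrite eq_trunc (leq_trans (le_trunc la)) // leq_add2r.
have := @sum_moveup (fun x => x - c) la i j k (sub0n _) ij; rewrite -/mu; lia.
Qed.
End Moveup.

(** The last hypothesis says that both exchanges change the multiset of positive parts alike. The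
    values x+k, x and y are matched in this order: were two candidates different, the multiplicity
    of the larger one would disagree. *)
Lemma exchange_data_inj x y k x' y' k' : 0 < k <= y -> y <= x -> 0 < k' <= y' -> y' <= x' ->
  (forall z, 0 < z -> (x + k == z) + (y - k == z) + (x' == z) + (y' == z) =
                      (x' + k' == z) + (y' - k' == z) + (x == z) + (y == z)) ->
  [/\ x = x', y = y' & k = k'].
Proof.
move=> /andP[k0 ky] yx /andP[k0' ky'] yx' h.
have lt_eqF u v : u < v -> (u == v) = false :> bool by move/ltn_eqF.
have e1 : x + k = x' + k'.
  case: (ltngtP (x + k) (x' + k')) => // lt_k.
    have : 0 < x' + k' by lia.
    by move/h; rewrite eqxx !(lt_eqF _ (x' + k')) //; lia.
  have : 0 < x + k by lia.
  by move/h; rewrite eqxx !(lt_eqF _ (x + k)) //; lia.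
have e2 : x = x'.
  case: (ltngtP x x') => // lt_x.
    have : 0 < x' by lia.
    move/h; rewrite eqxx e1 (lt_eqF (y' - k') x') ?(lt_eqF x x') ?(lt_eqF y x'); lia.
  have : 0 < x by lia.
  move/h; rewrite eqxx e1 (lt_eqF (y - k) x) ?(lt_eqF x' x) ?(lt_eqF y' x); lia.
have e3 : y = y'.
  case: (ltngtP y y') => // lt_y.
    have : 0 < y' by lia.
    move/h; rewrite eqxx e1 e2 (lt_eqF (y' - k') y') ?(lt_eqF y y'); lia.
  have : 0 < y by lia.
  move/h; rewrite eqxx e1 e2 (lt_eqF (y - k) y) ?(lt_eqF y' y); lia.
by split=> //; lia.
Qed.

Lemma moveup_data_inj la i j k i' j' k' : is_part la ->
  i < j < size la -> 0 < k <= nth 0 la j ->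
  i' < j' < size la -> 0 < k' <= nth 0 la j' ->
  moveup la i j k = moveup la i' j' k' ->
  [/\ nth 0 la i = nth 0 la i', nth 0 la j = nth 0 la j' & k = k'].
Proof.
move=> pl ij kj ij' kj' e; apply: exchange_data_inj => //.
- by apply: part_nth_geq => //; case/andP: ij => /ltnW.
- by apply: part_nth_geq => //; case/andP: ij' => /ltnW.
move=> z z0; pose g y : nat := y == z; have g0 : g 0 = 0 by rewrite /g eq_sym gtn_eqF.
have := @sum_moveup g la i j k g0 ij; have := @sum_moveup g la i' j' k' g0 ij'.
rewrite e -!/(g _); move: (\sum_(x <- la) _) (\sum_(x <- moveup _ _ _ _) _) => A B.
move: (g _) (g _) (g _) (g _) (g _) (g _) (g _) (g _); lia.
Qed.

Lemma moveup_eq la i j i' j' k : i < j < size la -> i' < j' < size la ->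
  nth 0 la i = nth 0 la i' -> nth 0 la j = nth 0 la j' ->
  moveup la i j k = moveup la i' j' k.
Proof.
move=> ij ij' ei ej; rewrite /moveup -!/(raise_lower _ _ _ _).
apply/(perm_sortP geq_total geq_trans geq_anti)/allP => x _ /=.
rewrite -!sum1_count !big_filter_cond !big_mkcondr /=.
pose g y := if 0 < y then if y == x then 1 else 0 else 0.
have := @sum_raise_lower g la i j k ij; have := @sum_raise_lower g la i' j' k ij'.
rewrite -ei -ej => <- /eqP; rewrite eqn_add2r -!(big_mkcond (fun y => 0 < y)) //.
Qed.

(** If x > y, the order of la forces i < j, so every pair counts. If x = y, the off-diagonal pairs
    are counted twice and the diagonal is added back. *)
Lemma count_pairs la x y : is_part la -> y <= x ->
  (1 + (x == y)) * (\sum_(i < size la) \sum_(j < size la | i < j)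
     (nth 0 la i == x) * (nth 0 la j == y)) + (x == y) * count_mem x la =
  count_mem x la * count_mem y la.
Proof.
move=> pl yx.
have cE z : count_mem z la = \sum_(i < size la) (nth 0 la i == z).
  rewrite -sum1_count (big_nth 0) big_mkord big_mkcond; apply: eq_bigr => i _ /=.
  by case: eqP.
have prodE : count_mem x la * count_mem y la =
    \sum_(i < size la) \sum_(j < size la) (nth 0 la i == x) * (nth 0 la j == y).
  by rewrite !cE big_distrl; apply: eq_bigr => i _; rewrite big_distrr.
move: yx; rewrite prodE leq_eqVlt => /orP[/eqP e|yx].
  rewrite e eqxx mul1n mulSn mul1n.
  have -> : \sum_(i < size la) \sum_(j < size la) (nth 0 la i == x) * (nth 0 la j == x) =
    \sum_(i < size la) \sum_(j < size la | i < j) (nth 0 la i == x) * (nth 0 la j == x) +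
    \sum_(i < size la) \sum_(j < size la | j < i) (nth 0 la i == x) * (nth 0 la j == x) +
    \sum_(i < size la) (nth 0 la i == x).
    rewrite -!big_split; apply: eq_bigr => i _ /=.
    rewrite (bigID (fun j : 'I__ => i < j)) /= -addnA; congr (_ + _).
    rewrite (bigD1 i) ?ltnn //= addnC; congr (_ + _); last by case: eqP.
    by apply: eq_bigl => j; rewrite -leqNgt [RHS]ltn_neqAle andbC.
  rewrite -cE; congr (_ + _ + _).
  rewrite (exchange_big_dep predT) //=; apply: eq_bigr => i _; apply: eq_bigr => j _.
  exact: mulnC.
rewrite gtn_eqF // mul0n addn0 mul1n; apply: eq_bigr => i _.
rewrite big_mkcond; apply: eq_bigr => j _; case: ltnP => // ji.
have := part_nth_geq pl ji; case: eqP => // ->; case: eqP => // ->.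
by rewrite leqNgt yx.
Qed.

End Combinatorics.

Lemma nth_leq_sumn (la : seq nat) i : (nth 0 la i <= sumn la)%N.
Proof.
elim: la i => [|x la IHla] [|i] //=; first exact: leq_addr.
by rewrite (leq_trans (IHla i)) ?leq_addl.
Qed.

(** * Collecting the moves with equal result into the coefficients r *)

Section Regroup.
Variables (K : fieldType) (a : K) (n : nat).
Hypothesis a0 : a != 0.
Hypothesis char0 : forall k, k.+1%:R != 0 :> K.
Notation q := (qg a n).

Definition rform (la : seq nat) (i j k : nat) : K :=
  let a := nth 0%N la i in let b := nth 0%N la j in
  let d : K := (a == b)%:R in
  (1 + d)^-1 * (count_mem a la)%:R * ((count_mem b la)%:R - d)
   * (a%:R - b%:R + 2%:R * k%:R).

Definition rcoef (la mu : seq nat) : K :=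
  if mu == la then evLB a la else
  if [pick t | @moveup_ok la mu t] is Some (i, j, k)
  then rform la i j k else 0.

(** Neither sorting nor deleting zeros changes the product, as Q_0 = 1. *)
Lemma qg_moveup la i j k : q (moveup la i j k) = q (raise_lower la i j k).
Proof.
rewrite /moveup -/(raise_lower la i j k) /qg (perm_big _ (permEl (perm_sort _ _))).
by rewrite big_filter big_mkcond; apply: eq_bigr => -[_|//]; rewrite Qg0.
Qed.

(** All triples leading to mu share la_i, la_j and k, so the summand is constant and [count_pairs]
    gives the number of terms. The triple chosen by [pick] is therefore immaterial. *)
Lemma sum_moveup_ok la mu : is_part la -> mu != la ->
  \sum_(t | @moveup_ok la mu t)
    ((nth 0%N la t.1.1)%:R - (nth 0%N la t.1.2)%:R + 2%:R * t.2%:R) = rcoef la mu.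
Proof.
move=> pl ne; rewrite /rcoef (negPf ne); case: pickP => [|none]; last by rewrite big_pred0.
case=> [[i0 j0] k0] ok0; have /and4P[ij0 k00 kj0 /eqP mu0] := ok0.
pose x := nth 0%N la i0; pose y := nth 0%N la j0; pose c0 : K := x%:R - y%:R + 2%:R * k0%:R.
have yx : (y <= x)%N by apply: part_nth_geq => //; apply: ltnW.
have okE t : @moveup_ok la mu t =
    ((t.1.1 < t.1.2)%N && (nth 0%N la t.1.1 == x) && (nth 0%N la t.1.2 == y)) && (t.2 == k0).
  case: t => [[i j] k] /=; apply/idP/idP => [/and4P[ij k1 kj /eqP mu1]|].
    have [||||| -> -> /val_inj ->] := @moveup_data_inj la i j k i0 j0 k0 pl.
    - by rewrite ij /=.
    - by rewrite k1.
    - by rewrite ij0 /=.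
    - by rewrite k00.
    - by rewrite mu1 mu0.
    by rewrite ij !eqxx.
  move=> /andP[/andP[/andP[ij /eqP ei] /eqP ej] /eqP ->].
  rewrite ij k00 ej kj0 /= -mu0; apply/eqP/moveup_eq; by rewrite ?ij ?ij0 ?ltn_ord.
transitivity (\sum_(t : 'I_(size la) * 'I_(size la) * 'I_(sumn la).+1 |
   ((t.1.1 < t.1.2)%N && (nth 0%N la t.1.1 == x) && (nth 0%N la t.1.2 == y)) && (t.2 == k0)) c0).
  apply: eq_big => [t|t]; first exact: okE.
  by rewrite okE => /andP[/andP[/andP[_ /eqP ->] /eqP ->] /eqP ->].
rewrite -(pair_big_dep (fun p : 'I_(size la) * 'I_(size la) =>
   (p.1 < p.2)%N && (nth 0%N la p.1 == x) && (nth 0%N la p.2 == y)) (fun _ k => k == k0)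
   (fun _ _ => c0)) /=.
under eq_bigr => p _ do rewrite big_pred1_eq.
have -> : \sum_(p : 'I_(size la) * 'I_(size la) |
      (p.1 < p.2)%N && (nth 0%N la p.1 == x) && (nth 0%N la p.2 == y)) c0 =
    (\sum_(i < size la) \sum_(j < size la | (i < j)%N)
       (nth 0%N la i == x) * (nth 0%N la j == y))%N%:R * c0.
  rewrite natr_sum mulr_suml.
  under [RHS]eq_bigr => i _ do rewrite natr_sum mulr_suml.
  rewrite pair_big_dep /= [RHS]big_mkcond [LHS]big_mkcond; apply: eq_bigr => p _ /=.
  by do !case: ifP => //; do !case: (_ == _); rewrite ?mul1r ?mul0r.
have := count_pairs pl yx; set P := (\sum_(i < size la) _)%N => e.
rewrite /rform -/x -/y -/c0; congr (_ * _).
have eK : (1 + (x == y)%:R) * P%:R + (x == y)%:R * (count_mem x la)%:R =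
  (count_mem x la)%:R * (count_mem y la)%:R :> K.
  by rewrite -!natrM -e natrD !natrM natrD.
have d0 : 1 + (x == y)%:R != 0 :> K by case: (x == y); rewrite ?addr0 ?oner_eq0 ?(char0 1).
by apply: (mulfI d0); rewrite -mulrA mulVKf // mulrBr -eK [_ * (x == y)%:R]mulrC addrK.
Qed.

Lemma LB_qg_rcoef la (mus : seq (seq nat)) :
  is_part la -> sumn la = n -> uniq mus -> la \in mus ->
  (forall mu, is_part mu -> dom_le la mu -> mu \in mus) ->
  LB a (q la) = 2%:R *: \sum_(mu <- mus) rcoef la mu *: q mu.
Proof.
move=> pl sl um lm closed; rewrite LB_qg //; last first.
  by apply/(all_nthP 0%N) => i _; rewrite -sl nth_leq_sumn.
congr (_ *: _); rewrite [RHS](bigD1_seq la) //= {1}/rcoef eqxx; congr (_ + _).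
pose c (i j k : nat) : K := (nth 0%N la i)%:R - (nth 0%N la j)%:R + 2%:R * k%:R.
(* The step k now runs over the index type of the triples in [moveup_ok], shifted by one so that k =
   0 is excluded by the condition. *)
transitivity (\sum_(i < size la) \sum_(j < size la | (i < j)%N)
    \sum_(k < (sumn la).+1 | (0 < k <= nth 0 la j)%N) c i j k *: q (moveup la i j k)).
  apply: eq_bigr => i _; apply: eq_bigr => j _.
  rewrite [RHS]big_mkcond big_ord_recl /= add0r.
  rewrite (big_ord_widen _ (fun k => c i j k.+1 *: q (raise_lower la i j k.+1))
     (nth_leq_sumn la j)) big_mkcond.
  by apply: eq_bigr => k _; rewrite /bump leq0n add1n qg_moveup.
rewrite pair_big_dep /= pair_big_dep /=.
(* Each term is written as a sum over the single mu equal to its result, so that exchanging the sums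
   collects terms by mu. *)
transitivity (\sum_(t : 'I_(size la) * 'I_(size la) * 'I_(sumn la).+1 |
    (t.1.1 < t.1.2)%N && (0 < t.2 <= nth 0 la t.1.2)%N)
  \sum_(mu <- mus | (mu != la) && (mu == moveup la t.1.1 t.1.2 t.2))
     c t.1.1 t.1.2 t.2 *: q mu).
  apply: eq_bigr => -[[i j] k] /andP[/= ij /andP[k0 kj]].
  have ijs : (i < j < size la)%N by rewrite ij ltn_ord.
  have mm : moveup la i j k \in mus by apply: closed; [apply: part_moveup | apply: dom_moveup].
  rewrite big_mkcond (bigD1_seq (moveup la i j k)) //= eqxx moveup_neq //=.
  by rewrite big1 ?addr0 // => mu /negPf ->; rewrite andbF.
rewrite (exchange_big_dep (fun mu => mu != la)) /= => [|t mu _ /andP[]//].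
apply: eq_bigr => mu ne; rewrite -sum_moveup_ok // scaler_suml.
apply: eq_bigl => -[[i j] k] /=; rewrite ne /= eq_sym -!andbA; do !case: (_ <= _)%N => //=.
Qed.
End Regroup.

(** * Pairing with products of the Q_k *)

Lemma mcoeffMX_if (n : nat) (R : nzRingType) (p : {mpoly R[n]}) (m e : 'X_{1..n}) :
  (p * 'X_[m])@_e = if (m <= e)%MM then p@_(e - m) else 0.
Proof.
case: ifP => h; first by rewrite -{1}(submK h) addmC mcoeffMX.
elim/mpolyind: p => [|c u p _ _ IHp]; first by rewrite mul0r mcoeff0.
rewrite mulrDl mcoeffD IHp addr0 -scalerAl mcoeffZ -mpolyXD mcoeffX.
case: eqP => [e_eq|_]; last by rewrite mulr0.
by case/negP: (negbT h); rewrite -e_eq; apply/mnm_lepP => i; rewrite mnmDE leq_addl.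
Qed.

Lemma mderiv_prod (n : nat) (R : comNzRingType) (I : eqType) (r : seq I)
    (G : I -> {mpoly R[n]}) (i : 'I_n) : uniq r ->
  (\prod_(j <- r) G j)^`M(i) = \sum_(j <- r) (G j)^`M(i) * \prod_(l <- r | l != j) G l.
Proof.
elim: r => [|x r IHr] /=; first by rewrite !big_nil -mpolyC1 mderivC.
case/andP=> xr ur; rewrite !big_cons mderivM IHr // eqxx /=; congr (_ * _ + _).
  rewrite [RHS]big_seq_cond [LHS]big_seq_cond; apply: eq_bigl => l.
  by case: (boolP (l \in r)) => //= lr; rewrite (memPn xr l lr).
rewrite mulr_sumr !big_seq; apply: eq_bigr => j jr.
by rewrite big_cons eq_sym (memPn xr j jr) mulrCA.
Qed.

Section Cauchy.
Variables (K : fieldType) (a : K) (n : nat).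
Hypothesis a0 : a != 0.
Hypothesis char0 : forall k, k.+1%:R != 0 :> K.
Notation L := {mpoly K[n]}.
Notation Q := (Qg a n).

Definition psumX (f : L) : L := f \mPo [tuple \sum_(j < n) 'X_j ^+ i.+1 | i < n].

Definition Qmnm (e : 'X_{1..n}) : L := \prod_(j < n) Q (e j).

(** Dual to multiplication by sum_j x_j^(i+1), whose coefficient at x^e collects those at the
    exponents e with one entry lowered by i+1. *)
Lemma deriv_Qmnm i e : (Qmnm e)^`M(i) =
  (a * i.+1%:R)^-1 *: \sum_(j < n | (U_(j) *+ i.+1 <= e)%MM) Qmnm (e - U_(j) *+ i.+1).
Proof.
rewrite /Qmnm mderiv_prod ?index_enum_uniq // scaler_sumr [RHS]big_mkcond.
apply: eq_bigr => j _; rewrite derivQ // -scalerAl.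
have le_e : (U_(j) *+ i.+1 <= e)%MM = (i.+1 <= e j)%N.
  apply/mnm_lepP/idP => [/(_ j)|h l]; rewrite mulmnE mnm1E ?eqxx ?mul1n //.
  by case: eqP => [<-|_]; rewrite ?mul1n ?mul0n.
rewrite le_e /Qsub; case: ifP => h; last by rewrite mul0r scaler0.
congr (_ *: _); rewrite [RHS](bigD1 j) //= mnmBE mulmnE mnm1E eqxx mul1n; congr (_ * _).
by apply: eq_bigr => l lj; rewrite mnmBE mulmnE mnm1E eq_sym (negPf lj) mul0n subn0.
Qed.

Lemma Qmnm_coeff0 e : (Qmnm e)@_0%MM = (e == 0%MM)%:R.
Proof.
rewrite /Qmnm rmorph_prod /=; have [->|e0] := eqVneq e 0%MM.
  by rewrite big1 // => j _; rewrite mnm0E Qg0 mcoeff1 eqxx.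
have [j ej] : exists j, e j != 0%N.
  case: (pickP (fun j => e j != 0%N)) => [j|no]; first by exists j.
  by case/eqP: e0; apply/mnmP => j; rewrite mnm0E; apply/eqP/negbFE/no.
by rewrite (bigD1 j) //= mcoeffQ pwt0 eq_sym (negPf ej) !mul0r.
Qed.

(* The pairing with products of the [Q_k] reads off monomial coefficients: both
   sides satisfy the same recursion under multiplication by a power sum. *)
Lemma mcoeff_psumX f e : (psumX f)@_e = jprod a f (Qmnm e).
Proof.
elim/mpolyind: f => [|c m f _ _ IHf].
  by rewrite /psumX comp_mpoly0 mcoeff0 jprodC jprod0r.
rewrite /psumX comp_mpolyD comp_mpolyZ mcoeffD mcoeffZ -!/(psumX _) IHf jprodDl jprodZl.
congr (_ * _ + _) => {c f IHf}.
elim: {m}(mdeg m) {-2}m (erefl (mdeg m)) e => [|d IHd] m.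
  move/eqP; rewrite mdeg_eq0 => /eqP -> e; rewrite /psumX comp_mpolyX big1 => [|i _].
    by rewrite mcoeff1 jprodX Qmnm_coeff0 wgt0 mulr1.
  by rewrite mnm0E.
move=> dm e; have [i mi] : exists i, m i != 0%N.
  case: (pickP (fun j => m j != 0%N)) => [j|no]; first by exists j.
  have m0 : m = 0%MM by apply/mnmP => j; rewrite mnm0E; apply/eqP/negbFE/no.
  by rewrite m0 mdeg0 in dm.
have eqm : (m - U_(i) + U_(i))%MM = m by rewrite submK // lep1mP.
have dm' : mdeg (m - U_(i))%MM = d by move: (congr1 mdeg eqm); rewrite mdegD mdeg1 addn1 dm => -[].
rewrite -eqm addmC mpolyXD /psumX rmorphM /= -/(psumX 'X_[m - U_(i)]) comp_mpolyXU.
rewrite -tnth_nth tnth_mktuple jprod_adj deriv_Qmnm jprodZr mulrA.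
have ai : a * i.+1%:R != 0 by rewrite mulf_neq0.
rewrite mulfV // mul1r jprod_sumr mulr_suml raddf_sum [RHS]big_mkcond.
apply: eq_bigr => j _ /=.
by rewrite mpolyXn mulrC mcoeffMX_if; case: ifP => // _; rewrite IHd.
Qed.

Definition expo (mu : seq nat) : 'X_{1..n} := [multinom nth 0%N mu j | j < n].

Lemma size_part mu : is_part mu -> (size mu <= sumn mu)%N.
Proof.
case/andP=> _; elim: mu => //= x mu IHmu /andP[x0 /IHmu h].
by rewrite -add1n leq_add.
Qed.

Lemma qg_expo mu : (size mu <= n)%N -> qg a n mu = Qmnm (expo mu).
Proof.
move=> sn; rewrite /qg /Qmnm (big_nth 0%N) big_mkord.
rewrite (big_ord_widen _ (fun i => Q (nth 0%N mu i)) sn) big_mkcond.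
apply: eq_bigr => i _; rewrite mnmE; case: ltnP => // h.
by rewrite nth_default // Qg0.
Qed.

Lemma val_expo mu : (size mu <= n)%N ->
  val (val (expo mu)) = mu ++ nseq (n - size mu) 0%N.
Proof.
move=> sn; apply: (@eq_from_nth _ 0%N) => [|i].
  by rewrite size_tuple size_cat size_nseq subnKC.
rewrite size_tuple => i_n; have := mnmE (fun j : 'I_n => nth 0%N mu j) (Ordinal i_n).
rewrite (mnm_nth 0%N) /= => ->; rewrite nth_cat; case: ltnP => // h.
by rewrite nth_nseq nth_default // if_same.
Qed.

Lemma part_of_expo mu : is_part mu -> (size mu <= n)%N -> part_of (expo mu) = mu.
Proof.
case/andP=> so pos sn; rewrite /part_of val_expo // filter_cat.
have -> : [seq x <- mu | (0 < x)%N] = mu by apply/all_filterP.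
have -> : [seq x <- nseq (n - size mu) 0%N | (0 < x)%N] = [::].
  by elim: (n - size mu)%N.
by rewrite cats0 (sorted_sort geq_trans).
Qed.

Lemma mdeg_expo mu : (size mu <= n)%N -> mdeg (expo mu) = sumn mu.
Proof.
move=> sn; rewrite mdegE sumnE (@sum_nth id _ n) //.
by apply: eq_bigr => i _; rewrite mnmE.
Qed.

Definition monoK (mu : seq nat) : L := \sum_(e : 'X_{1..n < n.+1} | part_of e == mu) 'X_[e].

Lemma mcoeff_mono mu nu : is_part mu -> sumn mu = n ->
  (monoK nu)@_(expo mu) = (mu == nu)%:R.
Proof.
move=> pm sm; have sz : (size mu <= n)%N by rewrite -sm size_part.
have lt_n : (mdeg (expo mu) < n.+1)%N by rewrite mdeg_expo // sm.
rewrite raddf_sum /= big_mkcond (bigD1 (BMultinom lt_n)) //= part_of_expo // mcoeffX eqxx.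
rewrite big1 ?addr0 => [|e ne]; first by case: eqP.
rewrite mcoeffX -[expo mu]/(bmnm (BMultinom lt_n)) (inj_eq val_inj) (negPf ne).
by case: ifP.
Qed.
End Cauchy.

(** * The determinant *)

Section Determinant.
Variables (K : fieldType) (n s : nat) (M : 'M[K]_s.+1) (C : 'cV[K]_s.+1).
Variables (q : 'I_s.+1 -> {mpoly K[n]}) (ev : K).
Hypothesis M_trig : forall i j : 'I_s.+1, (i < j)%N -> M i j = 0.
Hypothesis C0 : C ord0 0 = 1.
Hypothesis MC : M *m C = ev *: C.

Definition eigenmx : 'M[{mpoly K[n]}]_s.+1 := \matrix_(i < s.+1, j < s.+1)
  (if i == 0%N :> nat then q j else (M i j - (i == j)%:R * ev)%:MP).

(* Replacing the first column of [eigenmx] by its product with [C] does not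
   change the determinant since [C ord0 0 = 1]; that column is then zero below
   its first entry. *)
Lemma det_eigenmx : \det eigenmx =
  (\prod_(i < s) (M (lift ord0 i) (lift ord0 i) - ev)) *: \sum_i C i 0 *: q i.
Proof.
pose U : 'M[{mpoly K[n]}]_s.+1 := \matrix_(i, j)
  (if j == ord0 then (C i 0)%:MP else (i == j)%:R).
have detU : \det U = 1.
  rewrite det_trig; last first.
    apply/is_trig_mxP => i j ij; rewrite mxE -(inj_eq val_inj) gtn_eqF ?(leq_ltn_trans _ ij) //.
    by rewrite -(inj_eq val_inj) ltn_eqF.
  rewrite big1 // => i _; rewrite mxE eqxx; case: eqP => // ->.
  by rewrite C0.
have NU0 i : (eigenmx *m U) i ord0 = if i == ord0 then \sum_j C j 0 *: q j else 0.
  rewrite mxE; under eq_bigr => j _ do rewrite !mxE eqxx.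
  case: (eqVneq i ord0) => [->|i0] /=.
    by apply: eq_bigr => j _; rewrite mulrC mul_mpolyC.
  have -> : (i == 0%N :> nat) = false by apply/negbTE.
  under eq_bigr => j _ do rewrite -mpolyCM.
  rewrite -raddf_sum /= (_ : \sum_j _ = 0) ?mpolyC0 //.
  under eq_bigr => j _ do rewrite mulrBl.
  rewrite sumrB; have /matrixP/(_ i 0) := MC; rewrite !mxE => ->.
  rewrite (bigD1 i) //= eqxx mul1r big1 ?addr0 ?subrr // => j ji.
  by rewrite eq_sym (negPf ji) !mul0r.
have NUl i j : (eigenmx *m U) i (lift ord0 j) = eigenmx i (lift ord0 j).
  rewrite mxE (bigD1 (lift ord0 j)) //= [U _ _]mxE /= eqxx mulr1 big1 ?addr0 // => l lj.
  by rewrite [U _ _]mxE /= (negPf lj) mulr0.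
rewrite -[LHS]mulr1 -detU -det_mulmx (expand_det_col _ ord0) big_ord_recl NU0 eqxx.
rewrite [X in _ + X]big1 ?addr0 => [|i _]; last by rewrite NU0 mul0r.
rewrite /cofactor addn0 expr0 mul1r det_trig => [|]; last first.
  apply/is_trig_mxP => i j ij; rewrite mxE mxE NUl mxE /= M_trig //.
  by rewrite -(inj_eq val_inj) ltn_eqF // mul0r subr0 mpolyC0.
rewrite -mul_mpolyC mulrC rmorph_prod; congr (_ * _); apply: eq_bigr => i _.
by rewrite mxE mxE NUl mxE /= eqxx mul1r.
Qed.
End Determinant.

(** * The eigenvector and the determinant formula *)

Section Main.
Variables (K : fieldType) (pos : K -> Prop) (a : K).
Hypothesis cone_pos : cone pos.
Hypothesis pos_a : pos a.
Hypothesis a_transc : forall k l m : nat, k%:R * a + l%:R = m%:R -> k = 0%N.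

Let a0 : a != 0. Proof. exact: (cone_neq0 cone_pos). Qed.

Let char0 k : k.+1%:R != 0 :> K.
Proof. by apply: (cone_neq0 cone_pos); apply: cone_nat. Qed.

Lemma jprod_anisotropic n (f : {mpoly K[n]}) : jprod a f f = 0 -> f = 0.
Proof.
move=> f0; apply/mpolyP => m; rewrite mcoeff0.
have [|/memN_msupp_eq0 //] := boolP (m \in msupp f); apply: contraTeq => _.
rewrite mcoeff_msupp negbK; apply/eqP.
have [|/memN_msupp_eq0 //] := boolP (m \in msupp f).
apply: (cone_sum_sqr cone_pos (w := @wgt K a n)) f0 _ => u.
apply: (coneM cone_pos); first exact: (cone_exp cone_pos).
by apply: (cone_nat cone_pos); apply: zee_gt0.
Qed.

(** After doubling, equality would be a linear relation for alpha over the naturals whose leading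
    coefficient, the difference of the sums of squares, is positive. *)
Lemma evLB_inj la mu : is_part la -> is_part mu -> dom_le la mu -> la != mu ->
  evLB a mu != evLB a la.
Proof.
move=> pl pm dom ne; have lt := dom_sum_sqr_lt pl pm dom ne.
apply/eqP; rewrite /evLB.
set A := (\sum_(x <- mu) _)%N; set B := (\sum_(x <- la) _)%N.
set S := (\sum_(i < size mu) _)%N; set T := (\sum_(i < size la) _)%N => e.
have := @a_transc (A - B) (2 * T) (2 * S); rewrite natrB ?(ltnW lt) // !natrM => h.
suff : (A - B)%N = 0%N by move: lt; rewrite -/A -/B; lia.
apply: h; have two := char0 1.
have e2 := congr1 (fun x => 2%:R * x) e; rewrite /= !mulrBr !mulrA mulfV // !mul1r in e2.
have -> : (A%:R - B%:R) * a + 2%:R * T%:R = a * A%:R - (a * B%:R - 2%:R * T%:R) :> K by ring.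
by rewrite -e2; ring.
Qed.

Section Partition.
Variables (la : seq nat) (P : seq nat -> {mpoly K[sumn la]}).
Notation n := (sumn la).
Hypothesis part_la : is_part la.
Hypothesis P_mono : forall mu, is_part mu -> sumn mu = n ->
  exists c : seq nat -> K, psumX (P mu) = monoK K n mu
    + \sum_(nu <- parts n | dom_le nu mu && (nu != mu)) c nu *: monoK K n nu.

Lemma jprod_P mu ka : is_part mu -> sumn mu = n -> is_part ka -> sumn ka = n ->
  (ka = mu -> jprod a (P mu) (qg a n ka) = 1) /\
  (~~ dom_le ka mu -> jprod a (P mu) (qg a n ka) = 0).
Proof.
move=> pm sm pk sk; have [c e] := P_mono pm sm.
have -> : jprod a (P mu) (qg a n ka) = (ka == mu)%:R +
    \sum_(nu <- parts n | dom_le nu mu && (nu != mu)) c nu * (ka == nu)%:R.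
  rewrite qg_expo ?(leq_trans (size_part pk)) ?sk // -mcoeff_psumX // e mcoeffD.
  rewrite mcoeff_mono // raddf_sum /=; congr (_ + _); apply: eq_bigr => nu _.
  by rewrite mcoeffZ mcoeff_mono.
split=> [->|nd].
  rewrite eqxx big1 ?addr0 // => nu /andP[_ /negPf ne].
  by rewrite eq_sym ne mulr0.
rewrite big1 => [|nu /andP[d _]].
  by case: eqP nd => [->|]; rewrite ?dom_le_refl ?addr0.
by case: eqP nd => [->|_ _]; rewrite ?d ?mulr0.
Qed.

Variables (m0 : seq nat) (mus' : seq (seq nat)).
Notation mus := (m0 :: mus').
Notation s := (size mus').
Variable C : 'cV[K]_s.+1.
Hypothesis musE : forall mu, (mu \in mus) = is_part mu && dom_le la mu.
Hypothesis sorted_mus : sorted rlex_lt mus.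
Let q (i : 'I_s.+1) := qg a n (nth [::] mus i).
Let nrm := jprod a (P la) (P la).
Hypothesis QE : nrm^-1 *: P la = \sum_(i < s.+1) C i 0 *: q i.
Let M : 'M[K]_s.+1 := \matrix_(i < s.+1, j < s.+1) rcoef a (nth [::] mus j) (nth [::] mus i).

Let uniq_mus : uniq mus.
Proof. by apply: sorted_uniq sorted_mus; [apply: rlex_lt_trans | apply: rlex_lt_irr]. Qed.

Let mem_nth_mus (i : 'I_s.+1) : nth [::] mus i \in mus.
Proof. exact: mem_nth. Qed.

Let part_mus (i : 'I_s.+1) : is_part (nth [::] mus i).
Proof. by have := mem_nth_mus i; rewrite musE => /andP[]. Qed.

Let dom_mus (i : 'I_s.+1) : dom_le la (nth [::] mus i).
Proof. by have := mem_nth_mus i; rewrite musE => /andP[]. Qed.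

Let sumn_mus (i : 'I_s.+1) : sumn (nth [::] mus i) = n.
Proof. by have /dom_leP[] := dom_mus i. Qed.

Let rlex_mus (i j : 'I_s.+1) : (i < j)%N -> rlex_lt (nth [::] mus i) (nth [::] mus j).
Proof. by move=> ij; apply: (sorted_ltn_nth rlex_lt_trans) => //; apply: ltn_ord. Qed.

Let nth_mus_eq (i j : 'I_s.+1) : (nth [::] mus i == nth [::] mus j) = (i == j).
Proof. by rewrite nth_uniq //; apply: ltn_ord. Qed.

Let not_dom_mus (i j : 'I_s.+1) : (i < j)%N -> ~~ dom_le (nth [::] mus j) (nth [::] mus i).
Proof.
move=> ij; apply/negP => /(dom_rlex (part_mus j) (part_mus i)).
rewrite nth_mus_eq -(inj_eq val_inj) gtn_eqF // => /(_ isT) ji.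
by have := rlex_lt_trans (rlex_mus ij) ji; rewrite rlex_lt_irr.
Qed.

(** The partition la occurs in the list and is dominated by its head, which [not_dom_mus] forbids at
    any later position. *)
Let m0E : m0 = la.
Proof.
have la_mus : la \in mus by rewrite musE part_la dom_le_refl.
have := not_dom_mus (i := ord0) (j := Ordinal (_ : (index la mus < s.+1)%N)).
have lt_i : (index la mus < s.+1)%N by rewrite -[s.+1]/(size mus) index_mem.
move/(_ lt_i); rewrite /= nth_index // (dom_mus ord0).
by case: eqP => // _ /(_ isT).
Qed.

Let M_diag i : M i i = evLB a (nth [::] mus i).
Proof. by rewrite mxE /rcoef eqxx. Qed.

Let M_trig (i j : 'I_s.+1) : (i < j)%N -> M i j = 0.
Proof.
move=> ij; rewrite mxE /rcoef nth_mus_eq -(inj_eq val_inj) ltn_eqF //.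
case: pickP => // -[[i' j'] k] /and4P[i'j' k0 kj' /eqP e].
have := not_dom_mus ij; rewrite -e dom_moveup // i'j' /= ltn_ord //.
Qed.

Let A : 'M[K]_s.+1 := \matrix_(k, i) jprod a (P (nth [::] mus k)) (q i).

Let jprod_la i : jprod a (P la) (q i) = (i == ord0)%:R.
Proof.
have [h1 h2] := jprod_P part_la erefl (part_mus i) (sumn_mus i).
case: eqVneq => [e|i0]; first by rewrite h1 // e.
apply: h2; have := @not_dom_mus ord0 i; rewrite /= m0E; apply.
by rewrite lt0n.
Qed.

Let qg_indep (c : 'cV[K]_s.+1) : \sum_i c i 0 *: q i = 0 -> c = 0.
Proof.
move=> c0; have detA : \det A = 1.
  rewrite det_trig => [|]; last first.
    apply/is_trig_mxP => k i ki; rewrite mxE.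
    have [_ h] := jprod_P (part_mus k) (sumn_mus k) (part_mus i) (sumn_mus i).
    by apply: h; apply: not_dom_mus.
  rewrite big1 // => i _; rewrite mxE.
  by have [h _] := jprod_P (part_mus i) (sumn_mus i) (part_mus i) (sumn_mus i); apply: h.
have uA : A \in unitmx by rewrite unitmxE detA unitr1.
suff Ac : A *m c = 0 by rewrite -(mulKmx uA c) Ac mulmx0.
apply/matrixP => k j; rewrite ord1 [RHS]mxE mxE -[RHS](jprod0r a (P (nth [::] mus k))) -c0.
by rewrite jprod_sumr; apply: eq_bigr => i _; rewrite jprodZr mxE mulrC.
Qed.

Let nrm0 : nrm != 0.
Proof.
have [h _] := jprod_P part_la erefl part_la erefl.
apply/eqP => /jprod_anisotropic P0; have := h erefl.
by rewrite P0 jprodC jprod0r => /eqP; rewrite eq_sym oner_eq0.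
Qed.

Let C0 : C ord0 0 = 1.
Proof.
have : jprod a (P la) (nrm^-1 *: P la) = 1 by rewrite jprodZr mulVf.
rewrite QE jprod_sumr (bigD1 ord0) //= big1 => [|i i0].
  by rewrite jprodZr jprod_la eqxx mulr1 addr0.
by rewrite jprodZr jprod_la (negPf i0) mulr0.
Qed.

Let LB_q j : LB a (q j) = 2%:R *: \sum_i M i j *: q i.
Proof.
rewrite /q (@LB_qg_rcoef _ _ _ a0 char0 _ mus) //; last first.
  by move=> mu pm dm; rewrite musE pm (dom_le_trans (dom_mus j) dm).
by congr (_ *: _); rewrite (big_nth [::]) big_mkord; apply: eq_bigr => i _; rewrite mxE.
Qed.

(* The defect [D Q_la - e'_la Q_la] lies in the span of the [q_mu], [mu >= la],
   and is orthogonal to each of them, so it is isotropic, hence zero. *)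
Lemma rcoef_eigenvector : M *m C = evLB a la *: C.
Proof.
pose ev := evLB a la; pose d : 'cV[K]_s.+1 := M *m C - ev *: C.
pose Qla := \sum_i C i 0 *: q i; pose f := \sum_i d i 0 *: q i.
have LBQ : LB a Qla = 2%:R *: \sum_i (M *m C) i 0 *: q i.
  rewrite LB_sum scaler_sumr; under eq_bigr => j _ do rewrite LBZ LB_q scalerA scaler_sumr.
  rewrite exchange_big; apply: eq_bigr => i _ /=.
  rewrite mxE scaler_suml scaler_sumr; apply: eq_bigr => j _.
  by rewrite !scalerA; congr (_ *: _); ring.
have fE : 2%:R *: f = LB a Qla - (2%:R * ev) *: Qla.
  rewrite LBQ -scalerA -scalerBr; congr (_ *: _).
  rewrite /Qla scaler_sumr -sumrB; apply: eq_bigr => i _.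
  by rewrite /d !mxE scalerBl scalerA.
have Qq j : jprod a Qla (q j) = nrm^-1 * (j == ord0)%:R.
  by rewrite /Qla -QE jprodZl jprod_la.
have fq j : jprod a f (q j) = 0.
  apply: (mulfI (char0 1)); rewrite mulr0 -jprodZl fE -scaleN1r jprodDl !jprodZl.
  rewrite jprod_LB LB_q jprodZr jprod_sumr.
  under eq_bigr => i _ do rewrite jprodZr Qq.
  rewrite (bigD1 ord0) //= big1 ?addr0 => [|i /negPf ->]; last by rewrite !mulr0.
  rewrite Qq; case: (posnP j) => [j0|j_gt0].
    have -> : j = ord0 by apply: val_inj.
    by rewrite ?eqxx M_diag /= m0E -/ev; ring.
  by rewrite M_trig // -(inj_eq val_inj) gtn_eqF // !(mul0r, mulr0) addr0.
have f0 : f = 0.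
  apply: jprod_anisotropic; rewrite {2}/f jprod_sumr big1 // => i _.
  by rewrite jprodZr fq mulr0.
by apply/eqP; rewrite -subr_eq0; apply/eqP/qg_indep.
Qed.

Lemma Jack_determinant :
  nrm^-1 *: P la = (\prod_(1 <= i < s.+1)
     (evLB a (nth [::] mus i) - evLB a (nth [::] mus 0))^-1) *:
   \det (eigenmx M q (evLB a la)).
Proof.
rewrite (det_eigenmx q M_trig C0 rcoef_eigenvector) -QE scalerA.
rewrite big_add1 big_mkord -big_split big1 ?scale1r // => i _.
rewrite M_diag /= m0E mulVf // subr_eq0; apply: evLB_inj => //.
- exact: (part_mus (lift ord0 i)).
- exact: (dom_mus (lift ord0 i)).
by rewrite -m0E eq_sym (nth_mus_eq (lift ord0 i) ord0).
Qed.
End Partition.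
End Main.

(** * Specialisation to the rational functions in alpha *)

Lemma tofrac_transc (R : realDomainType) (k l m : nat) :
  k%:R * FracField.tofrac ('X : {poly R}) + l%:R = m%:R :> {fraction {poly R}} -> k = 0%N.
Proof.
rewrite -!(rmorph_nat (@FracField.tofrac {poly R})) -tofracM -tofracD => /eqP.
rewrite tofrac_eq => /eqP/(congr1 (fun p : {poly R} => p`_1)).
rewrite coefD -!polyC_natr !coefC /= addr0 coefCM coefX mulr1 => /eqP.
by rewrite pnatr_eq0 => /eqP.
Qed.

Lemma tofrac_X_pos (R : realDomainType) :
  frac_pos (fun p : {poly R} => 0 < lead_coef p) (FracField.tofrac 'X).
Proof.
by exists 'X, 1; split; rewrite ?lead_coefX ?lead_coef1 ?ltr01 // tofrac1 divr1.
Qed.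

Definition posF : F -> Prop := frac_pos (fun p : {poly rat} => 0 < lead_coef p).

Lemma cone_posF : cone posF.
Proof. exact: (frac_cone (lead_coef_cone _)). Qed.

Lemma posF_alpha : posF alpha.
Proof. exact: tofrac_X_pos. Qed.

Lemma alpha_transc (k l m : nat) : k%:R * alpha + l%:R = m%:R -> k = 0%N.
Proof. exact: tofrac_transc. Qed.

Theorem theorem5p9 (la : seq nat) (P : seq nat -> Lam (sumn la))
  (mus : seq (seq nat)) (C : 'cV[F]_(size mus)) :
  is_part la ->
  jackP_family P ->
  (forall mu, (mu \in mus) = is_part mu && dom_le la mu) ->
  sorted rlex_lt mus ->
  Qnorm (P la) = \sum_(i < size mus) C i 0 *: qp (sumn la) (nth [::] mus i) ->
  let s := size mus in
  let M : 'M[F]_s := \matrix_(i < s, j < s) r_coef (nth [::] mus j) (nth [::] mus i) in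
  let N : 'M[Lam (sumn la)]_s :=
    \matrix_(i < s, j < s)
      (if (i == 0%N :> nat) then qp (sumn la) (nth [::] mus j)
       else (M i j - (i == j)%:R * eprime la)%:MP) in
  let c : F := \prod_(1 <= i < s) (eprime (nth [::] mus i) - eprime (nth [::] mus 0))^-1 in
  M *m C = eprime la *: C /\ Qnorm (P la) = c *: \det N.
Proof.
move=> part_la [P_mono _] musE sorted_mus QE.
(* The list contains la, so it is nonempty and the matrices have a first row and column. *)
case: mus C musE sorted_mus QE => [|m0 mus] C musE sorted_mus QE.
  by have := musE la; rewrite part_la dom_le_refl.
split.
  exact (rcoef_eigenvector cone_posF posF_alpha part_la P_mono musE sorted_mus QE).
exact (Jack_determinant cone_posF posF_alpha alpha_transc part_la P_mono musE sorted_mus QE).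
Qed.
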